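(* Let $\alpha\in\{\pm\frac i3,\pm3i\}$ and, on a space with (complex) coordinates $(x,y,z,p,q)$, let $$\omega_1=\sigma_1-ie^{\alpha x}dq,\qquad \omega_2=\sigma_2+dx,\qquad \omega_3=\sigma_3+i\alpha e^{\alpha x}dq,$$ where $\sigma_1=i(dy+y\,dz)-i(y^2-1)(dp-p\,dz)$, $\sigma_2=dy+y\,dz-(y^2+1)(dp-p\,dz)$, $\sigma_3=-2iy(dp-p\,dz)+i\,dz$. Define functions $c_1,\dots,c_5$ as follows (upper or lower signs according to the sign of $\alpha$). If $\alpha=\pm\frac i3$: $$\begin{aligned} c_1&=-2e^{\frac z2}\big(e^{\mp\frac{ix}2}(y\pm i)\mp\tfrac43 iq\,e^{\mp\frac{ix}6}(y\mp i)\big),\\ c_2&=2e^{-\frac z2}\big(e^{\mp\frac{ix}2}(1+(y\pm i)p)\mp\tfrac43iq\,e^{\mp\frac{ix}6}(1+(y\mp i)p)\big),\\ c_3&=\tfrac23q,\qquad c_4=\pm i\,e^{\frac z2\mp\frac{ix}6}(y\mp i),\qquad c_5=\pm i\,e^{-\frac z2\mp\frac{ix}6}(1+(y\mp i)p). \end{aligned}$$ If $\alpha=\pm3i$ (on $y\neq0$): $$\begin{aligned} c_1&=\tfrac{16}{3y^2}e^{-\frac{3z}2\pm\frac{3ix}2}\big(2y(y\mp i)p+\tfrac14(5y\mp3i)\big),\\ c_2&=\tfrac{16}{3y^2}e^{-\frac{3z}2}\Big(q\,e^{\pm\frac{3ix}2}\big(2y(y\mp i)p+\tfrac14(5y\mp3i)\big)\pm\tfrac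 i3e^{\mp\frac{3ix}2}\big(2y(y\pm i)p+\tfrac14(5y\pm3i)\big)\Big),\\ c_3&=-\tfrac4{3y}e^{-z}(2py+1),\qquad c_4=-\tfrac1y e^{-\frac z2\pm\frac{3ix}2}(y\mp i),\\ c_5&=\tfrac1y e^{-\frac z2}\big(q\,e^{\pm\frac{3ix}2}(y\mp i)\pm\tfrac i3e^{\mp\frac{3ix}2}(y\pm i)\big). \end{aligned}$$ Then $(x,y,z,p,q)\mapsto(c_1,\dots,c_5)$ is a local change of coordinates under which the rolling distribution annihilated by $\omega_1,\omega_2,\omega_3$ is mapped to the flat Cartan distribution: the 1-forms $$\Theta_1=dc_1-2c_4\,dc_3-4c_3\,dc_4,\qquad \Theta_2=dc_2+2c_5\,dc_3+4c_3\,dc_5,\qquad \Theta_3=dc_3+c_5\,dc_4-c_4\,dc_5$$ span the same space as $\omega_1,\omega_2,\omega_3$. Consequently, for these values of $\alpha$ the rolling distribution is locally equivalent to the flat Cartan distribution, and to the Hilbert–Cartan distribution.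
   Context: Here $i^2=-1$. Everything is understood over $\mathbb C$: coordinates are holomorphic, 1-forms have complex-analytic coefficients, and spans are over the ring of complex-analytic functions. Two distributions are locally equivalent if there are local coordinate changes carrying the span of the annihilating 1-forms of one to that of the other. The flat Cartan distribution is the rank 2 distribution in coordinates $(a_1,\dots,a_5)$ annihilated by $$\theta_1=da_1+\big(a_3+\tfrac12a_4a_5\big)da_4,\quad \theta_2=da_2+\big(a_3-\tfrac12a_4a_5\big)da_5,\quad \theta_3=da_3+\tfrac12a_4\,da_5-\tfrac12a_5\,da_4 .$$ Under the coordinate change $(c_1,c_2,c_3,c_4,c_5)=(6a_1-2a_3a_4+a_4^2a_5,\;6a_2-2a_3a_5-a_4a_5^2,\;2a_3,\;-a_4,\;a_5)$ the span of $\theta_1,\theta_2,\theta_3$ is the span of $\Theta_1,\Theta_2,\Theta_3$, with the latter given by the formulas in the claim. The Hilbert–Cartan distribution is the rank 2 distribution in coordinates $(x,y,z,p,q)$ annihilated by $dy-p\,dx$, $dp-q\,dx$, $dz-q^2\,dx$. *)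

(* Defs.v *)
From HB Require Import structures.
From mathcomp Require Import all_boot all_order all_algebra.
From mathcomp Require Import all_classical all_reals all_analysis.
From mathcomp Require Import complex.

Set Implicit Arguments.
Unset Strict Implicit.
Unset Printing Implicit Defensive.

Import Order.TTheory GRing.Theory Num.Theory.
Import numFieldNormedType.Exports.
Local Open Scope classical_set_scope.
Local Open Scope ring_scope.

(* The field R[i], typed as a [numClosedFieldType] so that it inherits the
   topology and norm that the library attaches to every such field.  Hence
   ['rV[CC R]_5] is a normed space over [CC R], and [differentiable], ['d f u]
   and ['J f u] below are complex differentiability, complex differential and
   complex Jacobian. *)
Definition CC (R : realType) : numClosedFieldType := R[i].

Definition cexp (R : realType) (w : CC R) : CC R :=
  Complex (expR (complex.Re w) * cos (complex.Im w))
          (expR (complex.Re w) * sin (complex.Im w)).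

Section Forms.
Variable R : realType.
Local Notation C := (CC R).
Local Notation C5 := 'rV[C]_5.

Definition vec5 (a0 a1 a2 a3 a4 : C) : C5 :=
  \row_(k < 5) nth 0 [:: a0; a1; a2; a3; a4] k.

(* Only used on open sets U, where pointwise complex differentiability is the
   same as complex analyticity. *)
Definition holomorphic_on (W : normedModType C) (U : set C5) (f : C5 -> W) :=
  forall u, U u -> differentiable f u.

(* A 1-form is the field of its coefficient columns: the value of eta at the
   point u on the tangent vector v is [v *m eta u]. *)
Definition form := C5 -> 'cV[C]_5.

Definition dcoord (k : 'I_5) : 'cV[C]_5 := delta_mx k 0.

(* ['J phi u] satisfies [v *m 'J phi u = 'd phi u v]. *)
Definition pullback (phi : C5 -> C5) (eta : form) : form :=
  fun u => 'J phi u *m eta (phi u).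

(* A rank 2 distribution is given by three annihilating 1-forms. *)
Definition pfaffian := 'I_3 -> form.

Definition pfaffian3 (eta1 eta2 eta3 : form) : pfaffian :=
  fun i => nth eta1 [:: eta1; eta2; eta3] i.

Definition pullbacks (phi : C5 -> C5) (eta : pfaffian) : pfaffian :=
  fun i => pullback phi (eta i).

(* Span over the ring of holomorphic functions on U; forms are only looked at
   on U. *)
Definition form_span (U : set C5) (eta : pfaffian) : set form :=
  [set xi : form | exists f : 'I_3 -> C5 -> C^o,
     (forall i, holomorphic_on U (f i)) /\
     (forall u, U u -> xi u = \sum_(i < 3) f i u *: eta i u)].

Definition biholomorphic (U V : set C5) (phi : C5 -> C5) :=
  [/\ open U, open V, holomorphic_on U phi &
   exists psi : C5 -> C5,
     [/\ holomorphic_on V psi,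
         (forall u, U u -> V (phi u) /\ psi (phi u) = u) &
         (forall v, V v -> U (psi v) /\ phi (psi v) = v)]].

Definition local_coordinates (D : set C5) (phi : C5 -> C5) :=
  forall u, D u ->
    exists U V, [/\ U `<=` D, U u & biholomorphic U V phi].

Definition locally_equivalent_at (eta : pfaffian) (u : C5)
    (zeta : pfaffian) (v : C5) :=
  exists U V phi,
    [/\ U u, phi u = v, biholomorphic U V phi &
        form_span U eta = form_span U (pullbacks phi zeta)].

(* Every germ of each distribution is equivalent to a germ of the other. *)
Definition locally_equivalent (eta zeta : pfaffian) :=
  (forall u, exists v, locally_equivalent_at eta u zeta v) /\
  (forall v, exists u, locally_equivalent_at eta u zeta v).

(* Coordinates (a_1, ..., a_5). *)
Definition flat_cartan : pfaffian :=
  pfaffian3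
    (fun a => let a3 := a 0 2 in let a4 := a 0 3 in let a5 := a 0 4 in
       dcoord 0 + (a3 + 1 / 2 * a4 * a5) *: dcoord 3)
    (fun a => let a3 := a 0 2 in let a4 := a 0 3 in let a5 := a 0 4 in
       dcoord 1 + (a3 - 1 / 2 * a4 * a5) *: dcoord 4)
    (fun a => let a4 := a 0 3 in let a5 := a 0 4 in
       dcoord 2 + (1 / 2 * a4) *: dcoord 4 - (1 / 2 * a5) *: dcoord 3).

(* Coordinates (c_1, ..., c_5). *)
Definition Theta : pfaffian :=
  pfaffian3
    (fun c => let c3 := c 0 2 in let c4 := c 0 3 in
       dcoord 0 - (2 * c4) *: dcoord 2 - (4 * c3) *: dcoord 3)
    (fun c => let c3 := c 0 2 in let c5 := c 0 4 in
       dcoord 1 + (2 * c5) *: dcoord 2 + (4 * c3) *: dcoord 4)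
    (fun c => let c4 := c 0 3 in let c5 := c 0 4 in
       dcoord 2 + c5 *: dcoord 3 - c4 *: dcoord 4).

(* From here on the coordinates are (x, y, z, p, q). *)
Local Notation dx := (dcoord 0).
Local Notation dy := (dcoord 1).
Local Notation dz := (dcoord 2).
Local Notation dp := (dcoord 3).
Local Notation dq := (dcoord 4).

Definition hilbert_cartan : pfaffian :=
  pfaffian3
    (fun u => let p := u 0 3 in dy - p *: dx)
    (fun u => let q := u 0 4 in dp - q *: dx)
    (fun u => let q := u 0 4 in dz - q ^+ 2 *: dx).

Definition sigma1 : form := fun u =>
  let y := u 0 1 in let p := u 0 3 in
  'i *: (dy + y *: dz) - ('i * (y ^+ 2 - 1)) *: (dp - p *: dz).

Definition sigma2 : form := fun u =>
  let y := u 0 1 in let p := u 0 3 in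
  dy + y *: dz - (y ^+ 2 + 1) *: (dp - p *: dz).

Definition sigma3 : form := fun u =>
  let y := u 0 1 in let p := u 0 3 in
  - (2 * 'i * y) *: (dp - p *: dz) + 'i *: dz.

Definition rolling (alpha : C) : pfaffian :=
  pfaffian3
    (fun u => let x := u 0 0 in
       sigma1 u - ('i * cexp (alpha * x)) *: dq)
    (fun u => sigma2 u + dx)
    (fun u => let x := u 0 0 in
       sigma3 u + ('i * alpha * cexp (alpha * x)) *: dq).

(* In the next two maps s = 1 gives the upper signs (alpha = i/3, resp. 3i) and
   s = -1 the lower ones; j is the resulting +-i. *)
Definition chart_third (s : C) (u : C5) : C5 :=
  let x := u 0 0 in let y := u 0 1 in let z := u 0 2 in
  let p := u 0 3 in let q := u 0 4 in
  let j := s * 'i in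
  vec5
    (- 2 * cexp (z / 2) *
       (cexp (- (j * x / 2)) * (y + j)
        - 4 / 3 * j * q * cexp (- (j * x / 6)) * (y - j)))
    (2 * cexp (- (z / 2)) *
       (cexp (- (j * x / 2)) * (1 + (y + j) * p)
        - 4 / 3 * j * q * cexp (- (j * x / 6)) * (1 + (y - j) * p)))
    (2 / 3 * q)
    (j * cexp (z / 2 - j * x / 6) * (y - j))
    (j * cexp (- (z / 2) - j * x / 6) * (1 + (y - j) * p)).

Definition chart_three (s : C) (u : C5) : C5 :=
  let x := u 0 0 in let y := u 0 1 in let z := u 0 2 in
  let p := u 0 3 in let q := u 0 4 in
  let j := s * 'i in
  vec5
    (16 / (3 * y ^+ 2) * cexp (- (3 * z / 2) + 3 * j * x / 2) *
       (2 * y * (y - j) * p + 1 / 4 * (5 * y - 3 * j)))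
    (16 / (3 * y ^+ 2) * cexp (- (3 * z / 2)) *
       (q * cexp (3 * j * x / 2) *
          (2 * y * (y - j) * p + 1 / 4 * (5 * y - 3 * j))
        + j / 3 * cexp (- (3 * j * x / 2)) *
          (2 * y * (y + j) * p + 1 / 4 * (5 * y + 3 * j))))
    (- (4 / (3 * y)) * cexp (- z) * (2 * p * y + 1))
    (- (1 / y) * cexp (- (z / 2) + 3 * j * x / 2) * (y - j))
    (1 / y * cexp (- (z / 2)) *
       (q * cexp (3 * j * x / 2) * (y - j)
        + j / 3 * cexp (- (3 * j * x / 2)) * (y + j))).

End Forms.

(* Main.v *)
Require Import Defs.
From mathcomp Require Import all_boot all_order all_algebra.
From mathcomp Require Import all_classical all_reals all_analysis.
From mathcomp Require Import complex ring lra.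
Import Order.TTheory GRing.Theory Num.Theory.
Import numFieldNormedType.Exports.
Local Open Scope classical_set_scope.
Local Open Scope ring_scope.

(** Write j for the sign s times i, E = exp (z/2), and let X be the exponential
    of the multiple of j x that occurs in the chart: exp (- j x / 6) for
    alpha = j/3 and exp (3 j x / 2) for alpha = 3 j.  Every coefficient of the
    forms and of the charts is then a polynomial in j, E, X, y, p, q and the
    inverses of E, X and y, and the relations between the pulled back forms and
    omega_1, omega_2, omega_3 are identities modulo s^2 = 1 and i^2 = -1.  For
    alpha = j/3 these relations are
<<
      Theta_1 = E X^3 (j (y + j) omega_2 - (y - j) (s omega_1 + i omega_3))
      Theta_2 = X^3 / E (- j (1 + (y + j) p) omega_2
                         + (1 + (y - j) p) (s omega_1 + i omega_3))
      Theta_3 = X^2 (i omega_1 + s omega_3)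
>>
    and [chart_three_pull] is the analogue for alpha = 3 j.  In both cases the
    3 x 3 matrix of coefficients is invertible, with holomorphic inverse on the
    domain of the chart, so that the spans agree ([chart_third_span],
    [chart_three_span]).

    That the charts are local coordinates is shown by inverting them explicitly
    ([chart_third_local], [chart_three_local]).  For alpha = j/3 the 2 x 2 matrix with
    rows E X^3 (y + j), E X (y - j) and X^3 / E (1 + (y + j) p),
    X / E (1 + (y - j) p) is read off from c_1, ..., c_5; its determinant is
    2 j X^4, which gives x through a branch of the logarithm, and then E, y and p
    follow rationally, with a second logarithm for z.  For alpha = 3 j the
    combination (c_2 + 4 c_3 c_5) c_4 + (c_1 - 4 c_3 c_4) c_5 equals
    - (16/9) (y E^2)^-2, whose local square root gives y E^2, after which E X, y,
    E^2, X, p and q follow in turn.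

    For the local equivalences, each distribution is compared with the
    Hilbert-Cartan germ at the origin.  Hilbert-Cartan is homogeneous under a
    group of polynomial automorphisms ([hc_homogeneous]); the flat Cartan
    distribution and its form Theta are carried to it by polynomial
    automorphisms of C^5.  The rolling distributions are carried to Theta by the
    charts, except where alpha = 3 j and y = 0.  There one first moves the point
    off the hyperplane: sigma_1, sigma_2, sigma_3 are built from the
    Maurer-Cartan form of SL_2, hence invariant under left translations, and a
    unipotent one ([shear]) changes y. *)

Set Implicit Arguments.
Unset Strict Implicit.
Unset Printing Implicit Defensive.

(** * Derivatives at a point *)

Lemma cvg_shift0 {K : numFieldType} (T : topologicalType) (f : K -> T) (w : K) :
  {for w, continuous f} -> f (h + w) @[h --> 0] --> f w.
Proof.
by rewrite -[X in _ -> X]/((f \o shift w) @ (0:K) --> f w) cvg_comp_shift add0r.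
Qed.

Lemma cvg_increment {K : numFieldType} (f : K -> K) (w : K) :
  {for w, continuous f} -> f (h + w) - f w @[h --> 0] --> 0.
Proof.
move=> /cvg_shift0 cf A /nbhs_normP[e e0 eA]; apply: (cf (fun t => A (t - f w))).
apply/nbhs_normP; exists e => // t /= ht; apply: eA => /=.
by rewrite sub0r opprB.
Qed.

Lemma jacobian_comp (K : numFieldType) n m p (f : 'rV[K]_n -> 'rV[K]_m)
    (g : 'rV[K]_m -> 'rV[K]_p) u :
  differentiable f u -> differentiable g (f u) ->
  'J (g \o f) u = 'J f u *m 'J g (f u).
Proof.
move=> df dg; apply/row_matrixP => i.
by rewrite !rowE mulmxA /jacobian !mul_rV_lin1 diff_comp.
Qed.

Lemma jacobian_near_id (K : numFieldType) n (f : 'rV[K]_n -> 'rV[K]_n) u :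
  differentiable f u -> (\forall x \near u, f x = x) -> 'J f u = 1%:M.
Proof.
move=> df fE; apply/row_matrixP => k; rewrite !rowE mulmx1 /jacobian mul_rV_lin1.
rewrite -deriveE// (near_eq_derive (g := id))// deriveE; last first.
  exact: (ex_diff (is_diff_def := is_diff_id u)).
by rewrite (diff_val (is_diff_def := is_diff_id u)).
Qed.

Lemma sum3 (V : nmodType) (F : 'I_3 -> V) : \sum_(i < 3) F i = F 0 + F 1 + F 2.
Proof.
rewrite !big_ord_recr big_ord0 /= add0r.
by congr (F _ + F _ + F _); apply: val_inj.
Qed.

(** * Complex exponential and logarithm *)

Section cexp.
Variable R : realType.
Local Notation C := (CC R).
Implicit Types w h : C.

Lemma cexpD w h : cexp (w + h) = cexp w * cexp h.
Proof.
case: w h => [a b] [c d]; rewrite /cexp /= expRD cosD sinD.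
by congr Complex; rewrite /=; ring.
Qed.

Lemma cexp0 : cexp (0 : C) = 1.
Proof. by rewrite /cexp /= expR0 cos0 sin0 mulr1 mulr0. Qed.

Lemma cexp_neq0 w : cexp w != 0.
Proof.
apply/eqP => w0; have := cexpD w (- w).
by rewrite subrr cexp0 w0 mul0r => /eqP; rewrite oner_eq0.
Qed.

Lemma cexpN w : cexp (- w) = (cexp w)^-1.
Proof.
by apply: (mulfI (cexp_neq0 w)); rewrite -cexpD subrr cexp0 mulfV ?cexp_neq0.
Qed.

Lemma cexpX w n : cexp w ^+ n = cexp (w *+ n).
Proof.
by elim: n => [|n IH]; rewrite ?expr0 ?mulr0n ?cexp0// exprS IH mulrS cexpD.
Qed.

Lemma normRe_le h : (`|complex.Re h|)%:C%C <= `|h|.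
Proof. exact: normc_ge_Re. Qed.

Lemma normIm_le h : (`|complex.Im h|)%:C%C <= `|h|.
Proof.
have i1 : `|Complex 0 1| = 1 :> C by rewrite normc_def /= expr0n add0r expr1n sqrtr1.
by have := normc_ge_Re (h * Complex 0 1); rewrite ReiNIm normrN normrM i1 mulr1.
Qed.

Lemma norm_le_ReIm h : `|h| <= (`|complex.Re h| + `|complex.Im h|)%:C%C.
Proof.
rewrite normc_def lecR; set t := _ + `|complex.Im h|.
have -> : t = Num.sqrt (t ^+ 2) by rewrite sqrtr_sqr ger0_norm// addr_ge0.
rewrite ler_sqrt ?sqr_ge0// /t.
by rewrite sqrrD !real_normK ?num_real// -addrA lerD2l lerDr mulrn_wge0// mulr_ge0.
Qed.

Lemma near_Re (P : R -> Prop) : (\forall t \near (0 : R), P t) ->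
  \forall h \near (0 : C), P (complex.Re h).
Proof.
move=> /nbhs_normP[e /= e0 eP]; apply/nbhs_normP; exists (e%:C%C); first by rewrite /= ltcR.
move=> h /=; rewrite sub0r normrN => he; apply: eP => /=.
by rewrite sub0r normrN -ltcR (le_lt_trans (normRe_le h)).
Qed.

Lemma near_Im (P : R -> Prop) : (\forall t \near (0 : R), P t) ->
  \forall h \near (0 : C), P (complex.Im h).
Proof.
move=> /nbhs_normP[e /= e0 eP]; apply/nbhs_normP; exists (e%:C%C); first by rewrite /= ltcR.
move=> h /=; rewrite sub0r normrN => he; apply: eP => /=.
by rewrite sub0r normrN -ltcR (le_lt_trans (normIm_le h)).
Qed.

Lemma is_derive_near (f : R -> R) (d e : R) : is_derive (0:R) (1 : R) f d -> 0 < e ->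
  \forall t \near (0 : R), `|f t - f 0 - t * d| <= e * `|t|.
Proof.
move=> [/derivable_nbhs df dE] e0; rewrite dE in df.
move/eqaddoP : df => /(_ _ e0); apply: filterS => t /=.
by rewrite !fctE /= addr0 -[t *: 1]/(t * 1) mulr1 opprD addrA.
Qed.

(** Complex differentiability of the exponential at 0, from the real derivatives
    of exp, cos and sin at 0: with h = a + i b,
    e^a cos b - 1 - a = (e^a - 1 - a) + e^a (cos b - 1) and
    e^a sin b - b = e^a (sin b - b) + (e^a - 1) b. *)
Lemma cexp_near0 (e : C) : 0 < e ->
  \forall h \near (0 : C), `|cexp h - 1 - h| <= e * `|h|.
Proof.
case: e => e e'; rewrite ltcE /= => /andP[/eqP -> e0]; rewrite -[Complex e 0]/(e%:C)%C.
(* The two displayed sums are at most k|a| + 3k|b| and 5k|b|, hence the 9. *)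
pose k := Num.min 1 (e / 9).
have k0 : 0 < k by rewrite lt_min ltr01 divr_gt0.
have km : k <= 1 by rewrite ge_min lexx.
have ke : 9 * k <= e by rewrite mulrC -ler_pdivlMr// ge_min lexx orbT.
have ak : \forall h \near (0 : C), `|complex.Re h| < k.
  apply: (@near_Re (fun t => `|t| < k)).
  by apply/nbhs_normP; exists k => //= t; rewrite /= sub0r normrN.
have he := near_Re (is_derive_near (is_derive_expR 0) k0).
have hc := near_Im (is_derive_near (is_derive_cos 0) k0).
have hs := near_Im (is_derive_near (is_derive_sin 0) k0).
rewrite expR0 cos0 sin0 in he hc hs.
apply: filterS2 (filterI ak he) (filterI hc hs) => -[a b] /= [{}ak {}he] [{}hc {}hs].
rewrite !(mulr1, oppr0, mulr0, subr0, addr0) in he hc hs.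
apply: le_trans (norm_le_ReIm _) _ => /=.
have ha := normRe_le (Complex a b); have hb := normIm_le (Complex a b).
rewrite normc_def -rmorphM !lecR /= in ha hb *.
set n := Num.sqrt _ in ha hb *.
have E1 : `|expR a - 1| <= 2 * `|a|.
  rewrite (_ : expR a - 1 = (expR a - 1 - a) + a); last by ring.
  apply: le_trans (ler_normD _ _) _; rewrite mulrDl mul1r lerD2r.
  by apply: le_trans he _; rewrite ler_piMl.
have E2 : expR a <= 3.
  have := le_trans (ler_norm _) E1; lra.
have E0 := expR_gt0 a.
have a0 := normr_ge0 a; have b0 := normr_ge0 b.
have h1 : `|expR a * cos b - 1 - a| <= k * `|a| + 3 * (k * `|b|).
  rewrite (_ : _ - a = (expR a - 1 - a) + expR a * (cos b - 1)); last by ring.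
  apply: le_trans (ler_normD _ _) _; apply: lerD => //.
  by rewrite normrM (gtr0_norm E0) ler_pM.
have h2 : `|expR a * sin b - 0 - b| <= 3 * (k * `|b|) + 2 * k * `|b|.
  rewrite (_ : _ - b = expR a * (sin b - b) + (expR a - 1) * b); last by ring.
  apply: le_trans (ler_normD _ _) _; apply: lerD => //.
    by rewrite normrM (gtr0_norm E0) ler_pM.
  rewrite normrM ler_wpM2r//; apply: le_trans E1 _; rewrite ler_pM2l//; exact: ltW.
have hk : k * `|a| <= k * n by rewrite ler_pM2l.
have hn : 9 * k * n <= e * n by apply: ler_wpM2r => //; exact: le_trans a0 ha.
have hkn : k * `|b| <= k * n by rewrite ler_pM2l.
lra.
Qed.

(** The addition formula moves the estimate at 0 to every point. *)
Fact dcexp w : continuous (fun h : C => cexp w *: h) /\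
  @cexp R \o shift w = cst (cexp w) + (fun h : C => cexp w *: h) +o_ 0 id.
Proof.
split=> [? |]; first exact: scaler_continuous.
apply/eqaddoP => _ /posnumP[e].
have c0 : 0 < `|cexp w| by rewrite normr_gt0 cexp_neq0.
have := @cexp_near0 (e%:num / `|cexp w|); rewrite divr_gt0// => /(_ isT).
apply: filterS => h hh; rewrite !fctE /= cexpD.
rewrite (_ : _ - _ = cexp w * (cexp h - 1 - h)); last first.
  by rewrite -[cexp w *: h]/(cexp w * h); ring.
by rewrite normrM mulrC -ler_pdivlMr// mulrAC.
Qed.

Lemma is_diff_cexp w : is_diff w (@cexp R) ( *:%R (cexp w)).
Proof.
have dE : 'd (@cexp R) w = ( *:%R (cexp w)) :> (C -> C) .
  by apply: diff_unique; have [] := dcexp w.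
by apply: DiffDef => //; apply/diff_locallyP; rewrite dE; exact: dcexp.
Qed.

Lemma Re_continuous : continuous (@complex.Re R : C -> R).
Proof.
move=> w A /nbhs_normP[e /= e0 eA]; apply/nbhs_normP.
exists (e%:C%C) => /=; first by rewrite ltcR.
move=> h /= he; apply: eA => /=; rewrite -ltcR; apply: le_lt_trans he.
by have := normRe_le (w - h); case: (w) (h) => [a b] [c d].
Qed.

Lemma Im_continuous : continuous (@complex.Im R : C -> R).
Proof.
move=> w A /nbhs_normP[e /= e0 eA]; apply/nbhs_normP.
exists (e%:C%C) => /=; first by rewrite ltcR.
move=> h /= he; apply: eA => /=; rewrite -ltcR; apply: le_lt_trans he.
by have := normIm_le (w - h); case: (w) (h) => [a b] [c d].
Qed.

Lemma cvg_Complex (T : topologicalType) (f g : T -> R) (x : T) :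
  {for x, continuous f} -> {for x, continuous g} ->
  {for x, continuous (fun t => Complex (f t) (g t) : C)}.
Proof.
move=> /cvgrPdist_lt fx /cvgrPdist_lt gx A /nbhs_normP[[e e'] /=].
rewrite ltcE /= => /andP[/eqP -> e0] eA.
have e20 : 0 < e / 2 by rewrite divr_gt0.
apply: filterS2 (fx _ e20) (gx _ e20) => t ft gt; apply: eA => /=.
apply: le_lt_trans (norm_le_ReIm _) _; rewrite -[Complex e 0]/(e%:C)%C ltcR /= [e]splitr.
exact: ltrD.
Qed.

(** The principal branch of the logarithm, on the right half plane only: there the
    argument of a + i b is atan (b / a). *)
Definition clog w : C :=
  Complex (ln (complex.Re w ^+ 2 + complex.Im w ^+ 2) / 2)
    (atan (complex.Im w / complex.Re w)).

Lemma clogK w : 0 < complex.Re w -> cexp (clog w) = w.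
Proof.
case: w => a b /= a0; rewrite /cexp /clog /=.
set m := a ^+ 2 + b ^+ 2; set t := b / a.
have m0 : 0 < m by rewrite ltr_wpDr ?sqr_ge0// exprn_gt0.
have E2 : expR (ln m / 2) ^+ 2 = m by rewrite expr2 -expRD -splitr lnK.
have c0 : 0 < cos (atan t) by rewrite cos_gt0_pihalf// atan_gtNpi2 atan_ltpi2.
have Ec : expR (ln m / 2) * cos (atan t) = a.
  apply/eqP; rewrite -(@eqrXn2 _ 2) ?mulr_ge0 ?expR_ge0 ?(ltW c0) ?(ltW a0)//.
  rewrite exprMn E2 cos_atan exprVn sqr_sqrtr ?addr_ge0 ?sqr_ge0//.
  by apply/eqP; rewrite /m /t; field; rewrite -/m !gt_eqF.
have Es : sin (atan t) = t * cos (atan t).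
  by rewrite -{2}[t]atanK /tan divfK// gt_eqF.
by rewrite Ec Es mulrCA Ec /t divfK// gt_eqF.
Qed.

Lemma cexpK w : - (pi / 2) < complex.Im w < pi / 2 -> clog (cexp w) = w.
Proof.
case: w => a b /= hb; rewrite /clog /cexp /=.
have c0 : 0 < cos b by rewrite cos_gt0_pihalf.
rewrite !exprMn -mulrDr cos2Dsin2 mulr1 -expRM_natl expRK.
rewrite mulrC mulrA mulVf ?mul1r//.
have -> : expR a * sin b / (expR a * cos b) = tan b.
  by rewrite /tan; field; rewrite !gt_eqF// expR_gt0.
by rewrite tanK// in_itv.
Qed.

Lemma cvg_clog (T : topologicalType) (f g : T -> R) (x : T) :
  {for x, continuous f} -> {for x, continuous g} -> 0 < f x ->
  {for x, continuous (fun t => clog (Complex (f t) (g t)))}.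
Proof.
move=> cf cg fx; apply: cvg_Complex.
- apply: cvgM; last exact: cvg_cst.
  apply: (@continuous_comp _ _ _ (fun t => f t ^+ 2 + g t ^+ 2) (@ln R)).
    by apply: cvgD; apply: cvgM.
  by apply: continuous_ln; rewrite ltr_wpDr ?sqr_ge0// exprn_gt0.
- apply: (@continuous_comp _ _ _ (fun t => g t / f t) (@atan R)); last first.
    exact: continuous_atan.
  by apply: cvgM => //; apply: cvgV => //; rewrite gt_eqF.
Qed.

Lemma clog_continuous w : 0 < complex.Re w -> {for w, continuous clog}.
Proof.
move=> w0; have := cvg_clog (@Re_continuous w) (@Im_continuous w) w0.
by rewrite (_ : (fun t : C => _) = clog)//; apply/funext => -[].
Qed.

(** With k = clog (w + h) - clog w, the addition formula gives e^k = 1 + h / w, so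
    the estimate for e^k - 1 - k bounds h / w - k by a small multiple of |k|.
    Used once with the constant 1/2 it bounds |k| by 2 |h / w|, and then with the
    constant e |w| / 2 it bounds h / w - k by e |h|. *)
Fact dclog w : 0 < complex.Re w -> continuous (fun h : C => w^-1 *: h) /\
  clog \o shift w = cst (clog w) + (fun h : C => w^-1 *: h) +o_ 0 id.
Proof.
move=> w0; have wn0 : w != 0 by apply: contraTneq w0 => ->; rewrite ltxx.
split=> [? |]; first exact: scaler_continuous.
apply/eqaddoP => _ /posnumP[e].
have nw0 : 0 < `|w| by rewrite normr_gt0.
have d0 : 0 < e%:num * `|w| / 2 by rewrite divr_gt0 ?mulr_gt0.
have h0 : 0 < 2^-1 :> C by rewrite invr_gt0 ltr0n.
have cl := cvg_increment (clog_continuous w0).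
have rw : \forall h \near (0 : C), 0 < complex.Re (h + w).
  have cr := cvg_shift0 (@Re_continuous w).
  by apply: (cr (fun t => 0 < t)); exact: (lt_nbhsr w0).
have hk (d : C) : 0 < d -> \forall h \near (0 : C),
    `|cexp (clog (h + w) - clog w) - 1 - (clog (h + w) - clog w)| <=
    d * `|clog (h + w) - clog w| by move=> /cexp_near0; exact: cl.
apply: filterS3 (hk _ d0) (hk _ h0) rw => h {}hk hk2 hw; rewrite !fctE /=.
set k := clog (h + w) - clog w in hk hk2 *.
have kE : cexp k = 1 + w^-1 * h.
  by rewrite /k cexpD cexpN !clogK//; field.
rewrite kE (addrC 1) addrK distrC in hk hk2.
rewrite opprD addrA -/k -[w^-1 *: h]/(w^-1 * h).
apply: (le_trans hk).
suff lk : `|k| <= 2 * (`|w|^-1 * `|h|).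
  apply: le_trans (ler_wpM2l (ltW d0) lk) _.
  by rewrite le_eqVlt; apply/orP; left; apply/eqP; field; rewrite gt_eqF.
have : `|k| <= 2^-1 * `|k| + `|w|^-1 * `|h|.
  rewrite -normfV -normrM -{1}[k](subrK (w^-1 * h)).
  by apply: le_trans (ler_normD _ _) _; rewrite lerD2r.
rewrite -lerBlDl => lk; rewrite -ler_pdivrMl ?ltr0n//.
by apply: le_trans lk; rewrite le_eqVlt; apply/orP; left; apply/eqP; field.
Qed.

Lemma is_diff_clog w : 0 < complex.Re w -> is_diff w clog ( *:%R w^-1).
Proof.
move=> w0; have dE : 'd clog w = ( *:%R w^-1) :> (C -> C) .
  by apply: diff_unique; have [] := dclog w0.
by apply: DiffDef => //; apply/diff_locallyP; rewrite dE; exact: dclog.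
Qed.

(** [near_strip] and [near_right] provide the open conditions under which [clog]
    is a two-sided inverse of [cexp]. *)
Lemma near_strip (T : topologicalType) (f : T -> C) (x : T) :
  {for x, continuous f} -> f x = 0 ->
  \forall y \near x, - (pi / 2) < complex.Im (f y) < pi / 2.
Proof.
move=> cf fx; have p0 : 0 < pi / 2 :> R by rewrite divr_gt0 ?pi_gt0.
have I0 : complex.Im (0 : C) = 0 by [].
have N : nbhs (f x) (fun w : C => - (pi / 2) < complex.Im w < pi / 2).
  have h1 := @Im_continuous (f x) (fun t => t < pi / 2).
  have h2 := @Im_continuous (f x) (fun t => - (pi / 2) < t).
  rewrite fx I0 in h1 h2 *.
  have {}h1 : \forall w \near (0 : C), complex.Im w < pi / 2.
    by apply: h1; exact: lt_nbhsl.
  have {}h2 : \forall w \near (0 : C), - (pi / 2) < complex.Im w.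
    by apply: h2; apply: lt_nbhsr; rewrite oppr_lt0.
  by apply: filterS2 h1 h2 => w /= -> ->.
exact: cf _ N.
Qed.

Lemma near_right (T : topologicalType) (f : T -> C) (x : T) :
  {for x, continuous f} -> f x = 1 -> \forall y \near x, 0 < complex.Re (f y).
Proof.
move=> cf fx; have R1 : complex.Re (1 : C) = 1 by [].
have N : nbhs (f x) (fun w : C => 0 < complex.Re w).
  have h := @Re_continuous (f x) (fun t => 0 < t).
  by rewrite fx R1 in h *; apply: h; exact: lt_nbhsr.
exact: cf _ N.
Qed.

Lemma Re_neq0 w : 0 < complex.Re w -> w != 0.
Proof. by move=> w0; apply: contraTneq w0 => ->; rewrite ltxx. Qed.

Lemma Re1_gt0 : 0 < complex.Re (1 : C).
Proof. exact: ltr01. Qed.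

Lemma Im0_strip : - (pi / 2) < complex.Im (0 : C) < pi / 2.
Proof. by rewrite /= oppr_lt0 divr_gt0 ?pi_gt0. Qed.

Lemma clog1 : clog (1 : C) = 0.
Proof. by rewrite -cexp0 cexpK // Im0_strip. Qed.

Lemma ReV_gt0 w : 0 < complex.Re w -> 0 < complex.Re w^-1.
Proof.
by case: w => a b /= a0; rewrite divr_gt0// ltr_wpDr ?sqr_ge0// exprn_gt0.
Qed.

Lemma clogV w : 0 < complex.Re w -> clog w^-1 = - clog w.
Proof.
move=> w0; rewrite -{1}(clogK w0) -cexpN cexpK//.
by rewrite /= ltrN2 atan_ltpi2 ltrNl atan_gtNpi2.
Qed.
End cexp.

(** From here on these are treated as a variable field and variable functions;
    unfolding them to pairs of reals would only slow unification down. *)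
Opaque CC cexp clog.

(** * Gradients and pullbacks *)

Section gradient.
Variable R : realType.
Local Notation C := (CC R).
Local Notation C5 := 'rV[C]_5.
Implicit Types (f : C5 -> C) (u : C5) (g : 'cV[C]_5).

Definition has_gradient f u g := is_diff u f (fun v => (v *m g) 0 0).

Lemma has_gradient_differentiable f u g : has_gradient f u g -> differentiable f u.
Proof. by case. Qed.

Lemma gradient_eq f u df g :
  is_diff u f df -> (forall v, df v = (v *m g) 0 0) -> has_gradient f u g.
Proof. by move=> fu dfE; apply: is_diff_eq fu _; apply/funext. Qed.

Lemma gradient_cst (a : C) u : has_gradient (fun=> a) u 0.
Proof. by apply: (gradient_eq (is_diff_cst a u)) => v; rewrite mulmx0 mxE. Qed.

Lemma gradient_coord k u : has_gradient (fun u => u 0 k) u (dcoord R k).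
Proof.
have @c : {linear C5 -> C}.
  by exists (fun N : C5 => N 0 k); do 2![eexists]; do ?[constructor];
     rewrite ?mxE// => ? *; rewrite ?mxE//; move=> ?; rewrite !mxE.
have cc : continuous c by move=> ?; exact: coord_continuous.
have hc : is_diff u c c.
  by apply: DiffDef; [exact: linear_differentiable | exact: diff_lin].
by apply: (gradient_eq hc) => v; rewrite -colE mxE.
Qed.

Lemma gradientD f1 f2 u g1 g2 : has_gradient f1 u g1 -> has_gradient f2 u g2 ->
  has_gradient (fun u => f1 u + f2 u) u (g1 + g2).
Proof.
move=> h1 h2; apply: (gradient_eq (is_diffD h1 h2)) => v.
by rewrite mulmxDr [in RHS]mxE.
Qed.

Lemma gradientN f u g : has_gradient f u g -> has_gradient (fun u => - f u) u (- g).
Proof.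
by move=> h; apply: (gradient_eq (is_diffN h)) => v; rewrite mulmxN [in RHS]mxE.
Qed.

Lemma gradientM f1 f2 u g1 g2 : has_gradient f1 u g1 -> has_gradient f2 u g2 ->
  has_gradient (fun u => f1 u * f2 u) u (f1 u *: g2 + f2 u *: g1).
Proof.
move=> h1 h2; apply: (gradient_eq (is_diffM h1 h2)) => v.
by rewrite mulmxDr -!scalemxAr [in RHS]mxE [in RHS]mxE [X in _ = _ + X]mxE.
Qed.

Lemma gradientX f u g n : has_gradient f u g ->
  has_gradient (fun u => f u ^+ n.+1) u ((n.+1%:R * f u ^+ n) *: g).
Proof.
move=> h; have -> : (fun u => f u ^+ n.+1) = f ^+ n.+1.
  by apply/funext => x; rewrite exprfctE.
apply: (gradient_eq (is_diffX n h)) => v.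
by rewrite -scalemxAr [in RHS]mxE.
Qed.

Lemma gradient_comp (k : C -> C) (dk : C) f u g :
  is_diff (f u) k ( *:%R dk) -> has_gradient f u g ->
  has_gradient (fun u => k (f u)) u (dk *: g).
Proof.
move=> hk hf; apply: (gradient_eq (is_diff_comp hf hk)) => v.
by rewrite -scalemxAr [in RHS]mxE.
Qed.

Lemma gradientV f u g : f u != 0 -> has_gradient f u g ->
  has_gradient (fun u => (f u)^-1) u ((- f u ^- 2) *: g).
Proof.
move=> fu; apply: (gradient_comp (k := GRing.inv)).
exact: DiffDef (differentiable_Rinv fu) (diff_Rinv fu).
Qed.

Lemma gradient_cexp f u g : has_gradient f u g ->
  has_gradient (fun u => cexp (f u)) u (cexp (f u) *: g).
Proof. exact: gradient_comp (is_diff_cexp _). Qed.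

Lemma gradient_clog f u g : 0 < complex.Re (f u) -> has_gradient f u g ->
  has_gradient (fun u => clog (f u)) u ((f u)^-1 *: g).
Proof. by move=> fu; exact: gradient_comp (is_diff_clog _). Qed.

Lemma is_diff_sum n (F dF : 'I_n -> C5 -> C5) u :
  (forall i, is_diff u (F i) (dF i)) ->
  is_diff u (fun x => \sum_(i < n) F i x) (fun v => \sum_(i < n) dF i v).
Proof.
elim: n F dF => [|n IH] F dF h.
  under eq_fun do rewrite big_ord0.
  by under [X in is_diff_def _ _ X]eq_fun do rewrite big_ord0; exact: is_diff_cst.
under eq_fun do rewrite big_ord_recr.
under [X in is_diff_def _ _ X]eq_fun do rewrite big_ord_recr.
by apply: is_diffD => //; exact: IH.
Qed.

(** The columns g0, ..., g4 of the Jacobian of phi at u, through their effect on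
    1-forms. *)
Definition has_gradients (phi : C5 -> C5) u (g0 g1 g2 g3 g4 : 'cV[C]_5) :=
  forall eta : Defs.form R, pullback phi eta u =
    eta (phi u) 0 0 *: g0 + eta (phi u) 1 0 *: g1 + eta (phi u) 2 0 *: g2
    + eta (phi u) 3 0 *: g3 + eta (phi u) 4 0 *: g4.

Lemma has_gradients_vec5 f0 f1 f2 f3 f4 u g0 g1 g2 g3 g4 :
  has_gradient f0 u g0 -> has_gradient f1 u g1 -> has_gradient f2 u g2 ->
  has_gradient f3 u g3 -> has_gradient f4 u g4 ->
  has_gradients (fun u => vec5 (f0 u) (f1 u) (f2 u) (f3 u) (f4 u)) u g0 g1 g2 g3 g4.
Proof.
move=> h0 h1 h2 h3 h4; set phi := fun u => _.
pose f (k : 'I_5) := nth f0 [:: f0; f1; f2; f3; f4] k.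
pose g (k : 'I_5) := nth g0 [:: g0; g1; g2; g3; g4] k.
have hk k : has_gradient (f k) u (g k).
  by case: k => -[|[|[|[|[|//]]]]] ?.
have phiE : phi = fun u => \sum_(k < 5) f k u *: delta_mx 0 k.
  apply/funext => x; rewrite [LHS]row_sum_delta; apply: eq_bigr => k _.
  by rewrite mxE; case: k => -[|[|[|[|[|//]]]]] ?.
have dphi : is_diff u phi (fun v => \sum_(k < 5) (v *m g k) 0 0 *: delta_mx 0 k).
  rewrite phiE; apply: is_diff_sum => k; have [df dfE] := hk k.
  split; first exact: differentiableZl.
  by rewrite diffZl// dfE.
move=> eta; apply/colP => i; rewrite /pullback mxE.
have JE l : 'J phi u i l = g l i 0.
  rewrite /jacobian mxE (diff_val (is_diff_def := dphi)) summxE (bigD1 l)//= big1.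
    by rewrite addr0 [LHS]mxE [X in _ * X]mxE !eqxx mulr1 -rowE mxE.
  by move=> k kl; rewrite !mxE eq_sym (negbTE kl) andbF mulr0.
under eq_bigr do rewrite JE mulrC.
rewrite !big_ord_recr big_ord0 /= add0r !mxE.
by do 4?congr (_ + _); congr (eta _ _ _ * _); exact: val_inj.
Qed.

(** Gradients in coordinates: the rules below compute partial derivatives as
    explicit scalar expressions, which is what [ring] and [field] can compare. *)
Definition cov5 (a0 a1 a2 a3 a4 : C) : 'cV[C]_5 :=
  \col_(k < 5) nth 0 [:: a0; a1; a2; a3; a4] k.

Lemma colP5 (v w : 'cV[C]_5) :
  (forall n (hn : (n < 5)%N), v (Ordinal hn) 0 = w (Ordinal hn) 0) -> v = w.
Proof. by move=> vw; apply/colP => -[n hn]. Qed.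

Lemma cov5D a0 a1 a2 a3 a4 b0 b1 b2 b3 b4 :
  cov5 a0 a1 a2 a3 a4 + cov5 b0 b1 b2 b3 b4 =
  cov5 (a0 + b0) (a1 + b1) (a2 + b2) (a3 + b3) (a4 + b4).
Proof. by apply: colP5 => -[|[|[|[|[|//]]]]] ?; rewrite !mxE. Qed.

Lemma cov5N a0 a1 a2 a3 a4 :
  - cov5 a0 a1 a2 a3 a4 = cov5 (- a0) (- a1) (- a2) (- a3) (- a4).
Proof. by apply: colP5 => -[|[|[|[|[|//]]]]] ?; rewrite !mxE. Qed.

Lemma cov5Z c a0 a1 a2 a3 a4 :
  c *: cov5 a0 a1 a2 a3 a4 = cov5 (c * a0) (c * a1) (c * a2) (c * a3) (c * a4).
Proof. by apply: colP5 => -[|[|[|[|[|//]]]]] ?; rewrite !mxE. Qed.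

Lemma dcoord0E : dcoord R 0 = cov5 1 0 0 0 0.
Proof. by apply: colP5 => -[|[|[|[|[|//]]]]] ?; rewrite !mxE. Qed.
Lemma dcoord1E : dcoord R 1 = cov5 0 1 0 0 0.
Proof. by apply: colP5 => -[|[|[|[|[|//]]]]] ?; rewrite !mxE. Qed.
Lemma dcoord2E : dcoord R 2 = cov5 0 0 1 0 0.
Proof. by apply: colP5 => -[|[|[|[|[|//]]]]] ?; rewrite !mxE. Qed.
Lemma dcoord3E : dcoord R 3 = cov5 0 0 0 1 0.
Proof. by apply: colP5 => -[|[|[|[|[|//]]]]] ?; rewrite !mxE. Qed.
Lemma dcoord4E : dcoord R 4 = cov5 0 0 0 0 1.
Proof. by apply: colP5 => -[|[|[|[|[|//]]]]] ?; rewrite !mxE. Qed.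

Lemma has_gradient0 u : has_gradient (fun u => u 0 0) u (cov5 1 0 0 0 0).
Proof. by rewrite -dcoord0E; exact: gradient_coord. Qed.
Lemma has_gradient1 u : has_gradient (fun u => u 0 1) u (cov5 0 1 0 0 0).
Proof. by rewrite -dcoord1E; exact: gradient_coord. Qed.
Lemma has_gradient2 u : has_gradient (fun u => u 0 2) u (cov5 0 0 1 0 0).
Proof. by rewrite -dcoord2E; exact: gradient_coord. Qed.
Lemma has_gradient3 u : has_gradient (fun u => u 0 3) u (cov5 0 0 0 1 0).
Proof. by rewrite -dcoord3E; exact: gradient_coord. Qed.
Lemma has_gradient4 u : has_gradient (fun u => u 0 4) u (cov5 0 0 0 0 1).
Proof. by rewrite -dcoord4E; exact: gradient_coord. Qed.

Lemma has_gradient_cst (a : C) u : has_gradient (fun=> a) u (cov5 0 0 0 0 0).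
Proof.
suff -> : cov5 0 0 0 0 0 = 0 by exact: gradient_cst.
by apply: colP5 => -[|[|[|[|[|//]]]]] ?; rewrite !mxE.
Qed.

Lemma has_gradientD f1 f2 u a0 a1 a2 a3 a4 b0 b1 b2 b3 b4 :
  has_gradient f1 u (cov5 a0 a1 a2 a3 a4) ->
  has_gradient f2 u (cov5 b0 b1 b2 b3 b4) ->
  has_gradient (fun u => f1 u + f2 u) u
    (cov5 (a0 + b0) (a1 + b1) (a2 + b2) (a3 + b3) (a4 + b4)).
Proof. by rewrite -cov5D; exact: gradientD. Qed.

Lemma has_gradientN f u a0 a1 a2 a3 a4 :
  has_gradient f u (cov5 a0 a1 a2 a3 a4) ->
  has_gradient (fun u => - f u) u (cov5 (- a0) (- a1) (- a2) (- a3) (- a4)).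
Proof. by rewrite -cov5N; exact: gradientN. Qed.

Lemma has_gradientM f1 f2 u a0 a1 a2 a3 a4 b0 b1 b2 b3 b4 :
  has_gradient f1 u (cov5 a0 a1 a2 a3 a4) ->
  has_gradient f2 u (cov5 b0 b1 b2 b3 b4) ->
  has_gradient (fun u => f1 u * f2 u) u
    (cov5 (f1 u * b0 + f2 u * a0) (f1 u * b1 + f2 u * a1) (f1 u * b2 + f2 u * a2)
      (f1 u * b3 + f2 u * a3) (f1 u * b4 + f2 u * a4)).
Proof. by rewrite -cov5D -!cov5Z; exact: gradientM. Qed.

Lemma has_gradientMl c f u a0 a1 a2 a3 a4 :
  has_gradient f u (cov5 a0 a1 a2 a3 a4) ->
  has_gradient (fun u => c * f u) u
    (cov5 (c * a0) (c * a1) (c * a2) (c * a3) (c * a4)).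
Proof.
rewrite -cov5Z => h; have := gradientM (gradient_cst c u) h.
by rewrite scaler0 addr0.
Qed.

Lemma has_gradientX f u n a0 a1 a2 a3 a4 :
  has_gradient f u (cov5 a0 a1 a2 a3 a4) ->
  let c := n.+1%:R * f u ^+ n in
  has_gradient (fun u => f u ^+ n.+1) u
    (cov5 (c * a0) (c * a1) (c * a2) (c * a3) (c * a4)).
Proof. by rewrite /= -cov5Z; exact: gradientX. Qed.

Lemma has_gradientV f u a0 a1 a2 a3 a4 : f u != 0 ->
  has_gradient f u (cov5 a0 a1 a2 a3 a4) ->
  let c := - f u ^- 2 in
  has_gradient (fun u => (f u)^-1) u
    (cov5 (c * a0) (c * a1) (c * a2) (c * a3) (c * a4)).
Proof. by rewrite /= -cov5Z; exact: gradientV. Qed.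

Lemma has_gradient_cexp f u a0 a1 a2 a3 a4 :
  has_gradient f u (cov5 a0 a1 a2 a3 a4) ->
  let c := cexp (f u) in
  has_gradient (fun u => cexp (f u)) u
    (cov5 (c * a0) (c * a1) (c * a2) (c * a3) (c * a4)).
Proof. by rewrite /= -cov5Z; exact: gradient_cexp. Qed.

Lemma has_gradient_clog f u a0 a1 a2 a3 a4 : 0 < complex.Re (f u) ->
  has_gradient f u (cov5 a0 a1 a2 a3 a4) ->
  let c := (f u)^-1 in
  has_gradient (fun u => clog (f u)) u
    (cov5 (c * a0) (c * a1) (c * a2) (c * a3) (c * a4)).
Proof. by rewrite /= -cov5Z; exact: gradient_clog. Qed.

Lemma pullback_cov5 phi u g0 g1 g2 g3 g4 (eta : Defs.form R) e0 e1 e2 e3 e4 :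
  has_gradients phi u g0 g1 g2 g3 g4 -> eta (phi u) = cov5 e0 e1 e2 e3 e4 ->
  pullback phi eta u = e0 *: g0 + e1 *: g1 + e2 *: g2 + e3 *: g3 + e4 *: g4.
Proof. by move=> -> ->; rewrite !mxE. Qed.
End gradient.

(** Differentiates an explicit expression in the coordinates, leaving the gradient
    as an existential variable to be filled; remaining goals are the
    nonvanishing conditions for inverses and the half plane for logarithms. *)
Ltac gradient := lazymatch goal with
  | |- has_gradient (fun _ => ?a) _ _ => exact: has_gradient_cst
  | |- has_gradient (fun u => fun_of_matrix u _ 0) _ _ => exact: has_gradient0
  | |- has_gradient (fun u => fun_of_matrix u _ 1) _ _ => exact: has_gradient1
  | |- has_gradient (fun u => fun_of_matrix u _ 2) _ _ => exact: has_gradient2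
  | |- has_gradient (fun u => fun_of_matrix u _ 3) _ _ => exact: has_gradient3
  | |- has_gradient (fun u => fun_of_matrix u _ 4) _ _ => exact: has_gradient4
  | |- has_gradient (fun u => @?f u + @?g u) _ _ =>
      eapply (has_gradientD (f1 := f) (f2 := g)); gradient
  | |- has_gradient (fun u => - @?f u) _ _ => eapply (has_gradientN (f := f)); gradient
  | |- has_gradient (fun u => @?f u * @?g u) _ _ =>
      lazymatch f with
      | (fun _ => ?c) => eapply (@has_gradientMl _ c g)
      | _ => eapply (has_gradientM (f1 := f) (f2 := g))
      end; gradient
  | |- has_gradient (fun u => @?f u ^+ (S ?n)) _ _ =>
      eapply (@has_gradientX _ f _ n); gradient
  | |- has_gradient (fun u => cexp (@?f u)) _ _ =>
      eapply (has_gradient_cexp (f := f)); gradient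
  | |- has_gradient (fun u => (@?f u)^-1) _ _ =>
      eapply (has_gradientV (f := f)); [try exact: cexp_neq0|gradient]
  | |- has_gradient (fun u => clog (@?f u)) _ _ =>
      eapply (has_gradient_clog (f := f)); [|gradient]
  end.

Ltac gradients := cbv zeta; eapply has_gradients_vec5; gradient.

(** Differentiability alone, for the inverse charts, whose gradients are not needed
    and would be large; the functions are spelled pointwise so that the tactic
    below can match their syntax. *)
Section differentiable.
Variable R : realType.
Local Notation C := (CC R).
Local Notation C5 := 'rV[C]_5.
Implicit Types (f : C5 -> C) (u : C5).

Lemma dif_cst (a : C) u : differentiable (fun _ : C5 => a) u.
Proof. exact: has_gradient_differentiable (has_gradient_cst a u). Qed.

Lemma dif_coord k u : differentiable (fun u : C5 => u 0 k) u.
Proof. exact: has_gradient_differentiable (gradient_coord k u). Qed.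

Lemma difD f1 f2 u : differentiable f1 u -> differentiable f2 u ->
  differentiable (fun u => f1 u + f2 u) u.
Proof. exact: differentiableD. Qed.

Lemma difN f u : differentiable f u -> differentiable (fun u => - f u) u.
Proof. exact: differentiableN. Qed.

Lemma difM f1 f2 u : differentiable f1 u -> differentiable f2 u ->
  differentiable (fun u => f1 u * f2 u) u.
Proof. exact: differentiableM. Qed.

Lemma difX f n u : differentiable f u -> differentiable (fun u => f u ^+ n) u.
Proof.
move=> df; elim: n => [|n IH]; first exact: dif_cst.
by under eq_fun do rewrite exprS; exact: difM.
Qed.

Lemma difV f u : f u != 0 -> differentiable f u -> differentiable (fun u => (f u)^-1) u.
Proof. by move=> fu df; exact: differentiableV. Qed.

Lemma dif_cexp f u : differentiable f u -> differentiable (fun u => cexp (f u)) u.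
Proof. by move=> df; apply: (differentiable_comp df); have [] := is_diff_cexp (f u). Qed.

Lemma dif_clog f u : 0 < complex.Re (f u) -> differentiable f u ->
  differentiable (fun u => clog (f u)) u.
Proof. by move=> fu df; apply: (differentiable_comp df); have [] := is_diff_clog fu. Qed.

Lemma dif_vec5 f0 f1 f2 f3 f4 u :
  differentiable f0 u -> differentiable f1 u -> differentiable f2 u ->
  differentiable f3 u -> differentiable f4 u ->
  differentiable (fun u => vec5 (f0 u) (f1 u) (f2 u) (f3 u) (f4 u)) u.
Proof.
move=> h0 h1 h2 h3 h4.
pose f (k : 'I_5) := nth f0 [:: f0; f1; f2; f3; f4] k.
rewrite (_ : (fun u => _) =
    \sum_(k < 5) (fun u => f k u *: (delta_mx 0 k : C5))); last first.
  apply/funext => x; rewrite [LHS]row_sum_delta fct_sumE; apply: eq_bigr => k _.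
  by rewrite mxE; case: k => -[|[|[|[|[|//]]]]] ?.
apply: differentiable_sum => k; apply: differentiableZl.
by case: k => -[|[|[|[|[|//]]]]] ?.
Qed.
End differentiable.

Ltac differentiate := lazymatch goal with
  | |- differentiable (fun _ => ?a) _ => exact: dif_cst
  | |- differentiable (fun u => fun_of_matrix u _ _) _ => exact: dif_coord
  | |- differentiable (fun u => vec5 (@?f0 u) (@?f1 u) (@?f2 u) (@?f3 u) (@?f4 u)) _ =>
      apply: (@dif_vec5 _ f0 f1 f2 f3 f4); differentiate
  | |- differentiable (fun u => @?f u + @?g u) _ => apply: (@difD _ f g); differentiate
  | |- differentiable (fun u => - @?f u) _ => apply: (@difN _ f); differentiate
  | |- differentiable (fun u => @?f u * @?g u) _ => apply: (@difM _ f g); differentiate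
  | |- differentiable (fun u => @?f u ^+ ?n) _ => apply: (@difX _ f n); differentiate
  | |- differentiable (fun u => cexp (@?f u)) _ => apply: (@dif_cexp _ f); differentiate
  | |- differentiable (fun u => (@?f u)^-1) _ =>
      apply: (@difV _ f); [try exact: cexp_neq0|differentiate]
  | |- differentiable (fun u => clog (@?f u)) _ => apply: (@dif_clog _ f); [|differentiate]
  | |- differentiable _ _ => try assumption
  end.

(** * Spans of forms and equivalence of germs *)

Section germs.
Variable R : realType.
Local Notation C := (CC R).
Local Notation C5 := 'rV[C]_5.
Implicit Types (U V : set C5) (phi psi : C5 -> C5).
Implicit Types (eta zeta theta : pfaffian R) (xi : Defs.form R).

Lemma holomorphic_onS (W : normedModType C) U V (f : C5 -> W) :
  U `<=` V -> holomorphic_on V f -> holomorphic_on U f.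
Proof. by move=> UV fV u /UV; exact: fV. Qed.

Lemma holomorphic_on_comp (W : normedModType C) U V phi (f : C5 -> W) :
  holomorphic_on U phi -> (forall u, U u -> V (phi u)) -> holomorphic_on V f ->
  holomorphic_on U (f \o phi).
Proof.
by move=> hphi phiUV hf u Uu; apply: differentiable_comp; [exact: hphi|exact/hf/phiUV].
Qed.

Lemma open_preimage U V phi :
  open U -> open V -> holomorphic_on U phi -> open [set u | U u /\ V (phi u)].
Proof.
rewrite !openE => oU oV hphi u [Uu Vu]; rewrite /interior.
have cphi := differentiable_continuous (hphi _ Uu).
exact: filterI (oU _ Uu) (cphi _ (oV _ Vu)).
Qed.

Lemma span_gen U eta i : form_span U eta (eta i).
Proof.
exists (fun j => cst (j == i)%:R); split=> [j u _|u _]; first exact: differentiable_cst.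
rewrite (bigD1 i)//= eqxx scale1r big1 ?addr0// => j ji.
by rewrite (negbTE ji) scale0r.
Qed.

Lemma span_sub U eta zeta :
  (forall i, form_span U zeta (eta i)) -> form_span U eta `<=` form_span U zeta.
Proof.
move=> /choice[a aP] xi [f [fh xiE]].
exists (fun j u => \sum_i f i u * a i j u); split=> [j u Uu|u Uu].
  rewrite (_ : (fun u => _) = \sum_i (f i * a i j : C5 -> C)); last first.
    by apply/funext => x; rewrite fct_sumE.
  apply: differentiable_sum => i; apply: differentiableM; first exact: fh.
  by have [+ _] := aP i; apply.
rewrite xiE//; under eq_bigr => i _.
  rewrite (proj2 (aP i))// scaler_sumr; under eq_bigr do rewrite scalerA; over.
by rewrite exchange_big; apply: eq_bigr => j _; rewrite scaler_suml.
Qed.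

Lemma span_eq U eta zeta :
  (forall i, form_span U zeta (eta i)) -> (forall i, form_span U eta (zeta i)) ->
  form_span U eta = form_span U zeta.
Proof. by move=> h1 h2; apply/seteqP; split; exact: span_sub. Qed.

Lemma span_incl U V eta xi : U `<=` V -> form_span V eta xi -> form_span U eta xi.
Proof.
move=> UV [f [fh xiE]]; exists f; split=> [i|u /UV]; last exact: xiE.
exact: holomorphic_onS UV (fh i).
Qed.

Lemma span_eq_sub U V eta zeta : U `<=` V ->
  form_span V eta = form_span V zeta -> form_span U eta = form_span U zeta.
Proof.
move=> UV spanE; apply: span_eq => i; apply: (span_incl UV).
  by rewrite -spanE; exact: span_gen.
by rewrite spanE; exact: span_gen.
Qed.

Lemma eq_span U eta zeta : (forall u, U u -> forall i, eta i u = zeta i u) ->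
  form_span U eta = form_span U zeta.
Proof.
move=> etaE; apply/seteqP; split=> xi [f [fh xiE]]; exists f; split=> // u Uu;
  rewrite xiE//; apply: eq_bigr => i _; by rewrite etaE.
Qed.

Lemma pullback_span U V phi eta xi :
  holomorphic_on U phi -> (forall u, U u -> V (phi u)) ->
  form_span V eta xi -> form_span U (pullbacks phi eta) (pullback phi xi).
Proof.
move=> hphi UV [f [fh xiE]]; exists (fun i => f i \o phi); split=> [i|u Uu].
  exact: holomorphic_on_comp (fh i).
rewrite /pullback xiE; last exact: UV.
by rewrite mulmx_sumr; apply: eq_bigr => i _; rewrite -scalemxAr.
Qed.

Lemma span_eq_pullback U V phi eta zeta :
  holomorphic_on U phi -> (forall u, U u -> V (phi u)) ->
  form_span V eta = form_span V zeta ->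
  form_span U (pullbacks phi eta) = form_span U (pullbacks phi zeta).
Proof.
move=> hphi UV spanE; apply: span_eq => i; apply: pullback_span hphi UV _.
  by rewrite -spanE; exact: span_gen.
by rewrite spanE; exact: span_gen.
Qed.

Lemma pullback_comp phi psi xi u : differentiable phi u ->
  differentiable psi (phi u) ->
  pullback (psi \o phi) xi u = pullback phi (pullback psi xi) u.
Proof.
by move=> dphi dpsi; rewrite /pullback jacobian_comp// -mulmxA.
Qed.

Lemma biholomorphic_comp U1 V1 U2 V2 phi psi :
  biholomorphic U1 V1 phi -> biholomorphic U2 V2 psi ->
  exists V, biholomorphic [set u | U1 u /\ U2 (phi u)] V (psi \o phi).
Proof.
move=> [oU1 oV1 h1 [k1 [hk1 k1K K1]]] [oU2 oV2 h2 [k2 [hk2 k2K K2]]].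
exists [set v | V2 v /\ V1 (k2 v)]; split.
- exact: open_preimage.
- exact: open_preimage.
- apply: (holomorphic_on_comp (V := U2)) h2 => [|u []//].
  by apply: holomorphic_onS h1 => u [].
- exists (k1 \o k2); split=> [|u [U1u U2u]|v [V2v V1v]].
  + apply: (holomorphic_on_comp (V := V1)) hk1 => [|u []//].
    by apply: holomorphic_onS hk2 => u [].
  + have [V1u uE] := k1K _ U1u; have [V2u u2E] := k2K _ U2u.
    by rewrite /= u2E.
  + have [U2v vE] := K2 _ V2v; have [U1v v2E] := K1 _ V1v.
    by rewrite /= v2E.
Qed.

Lemma locally_equivalent_at_trans eta zeta theta u v w :
  locally_equivalent_at eta u zeta v -> locally_equivalent_at zeta v theta w ->
  locally_equivalent_at eta u theta w.
Proof.
move=> [U1 [V1 [phi [U1u phiu b1 e1]]]] [U2 [V2 [psi [U2v psiv b2 e2]]]].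
have [V bV] := biholomorphic_comp b1 b2.
exists [set u | U1 u /\ U2 (phi u)], V, (psi \o phi).
split=> //; [by rewrite /= phiu|by rewrite /= phiu|].
have [_ _ h1 _] := b1; have [_ _ h2 _] := b2.
rewrite (span_eq_sub (V := U1) _ e1); last by move=> ? [].
have h1' : holomorphic_on [set u | U1 u /\ U2 (phi u)] phi.
  by apply: holomorphic_onS h1 => ? [].
rewrite (span_eq_pullback h1' _ e2); last by move=> ? [].
apply: eq_span => x [U1x U2x] i; rewrite /pullbacks pullback_comp//.
  exact: h1.
exact: h2.
Qed.

Lemma locally_equivalent_at_sym eta zeta u v :
  locally_equivalent_at eta u zeta v -> locally_equivalent_at zeta v eta u.
Proof.
move=> [U [V [phi [Uu phiu b e]]]].
have [oU oV hphi [psi [hpsi psiK phiK]]] := b.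
exists V, U, psi; split.
- by have [+ _] := psiK _ Uu; rewrite phiu.
- by have [_] := psiK _ Uu; rewrite phiu.
- by split=> //; exists phi.
rewrite (span_eq_pullback hpsi _ e); last by move=> x /phiK[].
apply: eq_span => x Vx i; rewrite /pullbacks.
have [Ux xE] := phiK _ Vx.
(* phi o psi is the identity near x, so its Jacobian there is the identity. *)
rewrite -pullback_comp; [|exact: hpsi|exact: hphi].
rewrite /pullback /= xE.
rewrite jacobian_near_id ?mul1mx//.
  by apply: differentiable_comp; [exact: hpsi|apply: hphi].
have := oV; rewrite openE => /(_ _ Vx); rewrite /interior; apply: filterS => y Vy.
by have [] := phiK _ Vy.
Qed.

(** Inverse functions need only be known near a point and its image: shrinking to
    U0 and phi^-1 V0 on one side, V0 and psi^-1 U0 on the other, makes them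
    mutually inverse bijections between open sets. *)
Lemma biholomorphic_germ phi psi u v : phi u = v ->
  (\forall x \near u, differentiable phi x) ->
  (\forall y \near v, differentiable psi y) ->
  (\forall x \near u, psi (phi x) = x) ->
  (\forall y \near v, phi (psi y) = y) ->
  forall D, open D -> D u ->
  exists U V, [/\ U `<=` D, U u & biholomorphic U V phi].
Proof.
move=> phiu dphi dpsi psiK phiK D oD Du.
pose U0 := interior (D `&` [set x | differentiable phi x /\ psi (phi x) = x]).
pose V0 := interior [set y | differentiable psi y /\ phi (psi y) = y].
have U0u : U0 u.
  by apply: filterI; [rewrite openE in oD; exact: oD|exact: filterI].
have V0v : V0 v by exact: filterI.
have U0E x : U0 x -> [/\ D x, differentiable phi x & psi (phi x) = x].
  by move=> /interior_subset[? []].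
have V0E y : V0 y -> differentiable psi y /\ phi (psi y) = y.
  by move=> /interior_subset.
have h1 : holomorphic_on U0 phi by move=> x /U0E[].
have h2 : holomorphic_on V0 psi by move=> x /V0E[].
exists [set x | U0 x /\ V0 (phi x)], [set y | V0 y /\ U0 (psi y)]; split.
- by move=> x [/U0E[]].
- by rewrite /= phiu.
split.
- by apply: open_preimage => //; exact: open_interior.
- by apply: open_preimage => //; exact: open_interior.
- by apply: holomorphic_onS h1 => x [].
- exists psi; split=> [|x [U0x V0x]|y [V0y U0y]].
  + by apply: holomorphic_onS h2 => x [].
  + by have [_ _ xE] := U0E _ U0x; rewrite /= xE.
  + by have [_ yE] := V0E _ V0y; rewrite /= yE.
Qed.

Lemma locally_equivalent_at_chart D phi eta zeta u :
  local_coordinates D phi -> form_span D eta = form_span D (pullbacks phi zeta) ->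
  D u -> locally_equivalent_at eta u zeta (phi u).
Proof.
move=> lc spanE Du; have [U [V [UD Uu b]]] := lc u Du.
by exists U, V, phi; split=> //; exact: span_eq_sub UD _.
Qed.

(** Equivalence of germs is symmetric and transitive, so two distributions all of
    whose germs are equivalent to one fixed germ are locally equivalent. *)
Lemma locally_equivalent_model eta zeta theta w :
  (forall u, locally_equivalent_at eta u theta w) ->
  (forall v, locally_equivalent_at zeta v theta w) ->
  locally_equivalent eta zeta.
Proof.
move=> etaE zetaE; split=> [u|v].
  exists 0; apply: locally_equivalent_at_trans (etaE u) _.
  exact: locally_equivalent_at_sym (zetaE 0).
exists 0; apply: locally_equivalent_at_trans (etaE 0) _.
exact: locally_equivalent_at_sym (zetaE v).
Qed.

Lemma form_span3 U eta xi (a0 a1 a2 : C5 -> C) :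
  (forall u, U u -> differentiable a0 u) ->
  (forall u, U u -> differentiable a1 u) ->
  (forall u, U u -> differentiable a2 u) ->
  (forall u, U u -> xi u = a0 u *: eta 0 u + a1 u *: eta 1 u + a2 u *: eta 2 u) ->
  form_span U eta xi.
Proof.
move=> h0 h1 h2 xiE; exists (fun i : 'I_3 => nth a0 [:: a0; a1; a2] i).
by split=> [[[|[|[|//]]] ?]|u Uu] //; rewrite xiE// sum3.
Qed.

Lemma global_equivalence phi psi eta zeta :
  (forall u, differentiable phi u) -> (forall u, differentiable psi u) ->
  cancel phi psi -> cancel psi phi ->
  form_span setT eta = form_span setT (pullbacks phi zeta) ->
  forall u, locally_equivalent_at eta u zeta (phi u).
Proof.
move=> dphi dpsi phiK psiK spanE u; exists setT, setT, phi; split=> //.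
split=> //; [exact: openT|exact: openT|].
by exists psi; split=> // *; split.
Qed.
End germs.

(** * The polynomial models *)

(** Evaluates a pullback from the gradients G of the map and the coefficients E of
    the form at the image point. *)
Ltac pull G E :=
  rewrite (pullback_cov5 G E) !(scale0r, scale1r, add0r, addr0)
    ?(cov5Z, cov5N, cov5D).
Ltac holomorphic := move=> ? _; differentiate.
Section models.
Variable R : realType.
Local Notation C := (CC R).
Local Notation C5 := 'rV[C]_5.

Lemma vec5_eq (a0 a1 a2 a3 a4 : C) (v : C5) :
  a0 = v 0 0 -> a1 = v 0 1 -> a2 = v 0 2 -> a3 = v 0 3 -> a4 = v 0 4 ->
  vec5 a0 a1 a2 a3 a4 = v.
Proof.
move=> -> -> -> -> ->; apply/rowP => k; rewrite mxE.
by case: k => -[|[|[|[|[|//]]]]] ki /=; congr (v _ _); apply: val_inj.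
Qed.

Lemma forall_ord3 (P : 'I_3 -> Prop) : P 0 -> P 1 -> P 2 -> forall i, P i.
Proof.
move=> P0 P1 P2 [[|[|[|//]]] hi]; [move: P0|move: P1|move: P2]; congr P; exact: val_inj.
Qed.

Lemma cov5_eq (a0 a1 a2 a3 a4 b0 b1 b2 b3 b4 : C) :
  a0 = b0 -> a1 = b1 -> a2 = b2 -> a3 = b3 -> a4 = b4 ->
  cov5 a0 a1 a2 a3 a4 = cov5 b0 b1 b2 b3 b4.
Proof. by move=> -> -> -> -> ->. Qed.

(** Translation by w in the five-dimensional nilpotent group of symmetries of the
    Hilbert-Cartan equation z' = (y'')^2: to y it adds a quadratic polynomial in x,
    and p, q and z change accordingly. *)
Definition hc_shift (w u : C5) : C5 :=
  vec5 (u 0 0 + w 0 0)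
    (u 0 1 + w 0 1 + w 0 3 * u 0 0 + w 0 4 / 2 * u 0 0 ^+ 2)
    (u 0 2 + w 0 2 + 2 * w 0 4 * u 0 3 + w 0 4 ^+ 2 * u 0 0)
    (u 0 3 + w 0 3 + w 0 4 * u 0 0)
    (u 0 4 + w 0 4).

Definition hc_unshift (w u : C5) : C5 :=
  let x := u 0 0 - w 0 0 in
  let p := u 0 3 - w 0 3 - w 0 4 * x in
  vec5 x
    (u 0 1 - w 0 1 - w 0 3 * x - w 0 4 / 2 * x ^+ 2)
    (u 0 2 - w 0 2 - 2 * w 0 4 * p - w 0 4 ^+ 2 * x)
    p
    (u 0 4 - w 0 4).

Lemma hc_unshiftK w : cancel (hc_unshift w) (hc_shift w).
Proof. by move=> u; apply: vec5_eq; rewrite /hc_unshift !mxE /=; field. Qed.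

Lemma hc_shiftK w : cancel (hc_shift w) (hc_unshift w).
Proof.
by move=> u; apply: vec5_eq; rewrite /hc_shift !mxE /=; by field.
Qed.

Lemma hcE (u : C5) : (@hilbert_cartan R 0 u = cov5 (- u 0 3) 1 0 0 0) *
 (@hilbert_cartan R 1 u = cov5 (- u 0 4) 0 0 1 0) *
 (@hilbert_cartan R 2 u = cov5 (- u 0 4 ^+ 2) 0 1 0 0).
Proof.
rewrite /hilbert_cartan /pfaffian3 /= dcoord0E dcoord1E dcoord2E dcoord3E.
rewrite !(cov5Z, cov5N, cov5D).
by do !split; apply: cov5_eq; ring.
Qed.

Lemma flatE (a : C5) :
 (@flat_cartan R 0 a = cov5 1 0 0 (a 0 2 + 1 / 2 * a 0 3 * a 0 4) 0) *
 (@flat_cartan R 1 a = cov5 0 1 0 0 (a 0 2 - 1 / 2 * a 0 3 * a 0 4)) *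
 (@flat_cartan R 2 a = cov5 0 0 1 (- (1 / 2 * a 0 4)) (1 / 2 * a 0 3)).
Proof.
rewrite /flat_cartan /pfaffian3 /= dcoord0E dcoord1E dcoord2E dcoord3E dcoord4E.
rewrite !(cov5Z, cov5N, cov5D).
by do !split; apply: cov5_eq; ring.
Qed.

Lemma ThetaE (c : C5) :
 (@Theta R 0 c = cov5 1 0 (- (2 * c 0 3)) (- (4 * c 0 2)) 0) *
 (@Theta R 1 c = cov5 0 1 (2 * c 0 4) 0 (4 * c 0 2)) *
 (@Theta R 2 c = cov5 0 0 1 (c 0 4) (- c 0 3)).
Proof.
rewrite /Theta /pfaffian3 /= dcoord0E dcoord1E dcoord2E dcoord3E dcoord4E.
rewrite !(cov5Z, cov5N, cov5D).
by do !split; apply: cov5_eq; ring.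
Qed.

Lemma rollingE alpha (u : C5) (y := u 0 1) (p := u 0 3) (e := cexp (alpha * u 0 0)) :
 (rolling alpha 0 u = cov5 0 'i ('i * y + 'i * (y ^+ 2 - 1) * p)
    (- ('i * (y ^+ 2 - 1))) (- ('i * e))) *
 (rolling alpha 1 u = cov5 1 1 (y + (y ^+ 2 + 1) * p) (- (y ^+ 2 + 1)) 0) *
 (rolling alpha 2 u = cov5 0 0 (2 * 'i * y * p + 'i) (- (2 * 'i * y)) ('i * alpha * e)).
Proof.
rewrite /rolling /pfaffian3 /= /sigma1 /sigma2 /sigma3.
rewrite !dcoord0E !dcoord1E !dcoord2E !dcoord3E !dcoord4E !(cov5Z, cov5N, cov5D).
by do !split; apply: cov5_eq; rewrite -/y -/p -/e; ring.
Qed.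

Lemma hc_shift_differentiable w u : differentiable (hc_shift w) u.
Proof. by rewrite /hc_shift; cbv zeta; differentiate. Qed.

Lemma hc_unshift_differentiable w u : differentiable (hc_unshift w) u.
Proof. by rewrite /hc_unshift; cbv zeta; differentiate. Qed.

Lemma hc_shift_pull w u :
  (pullbacks (hc_shift w) (@hilbert_cartan R) 0 u = @hilbert_cartan R 0 u) *
  (pullbacks (hc_shift w) (@hilbert_cartan R) 1 u = @hilbert_cartan R 1 u) *
  (pullbacks (hc_shift w) (@hilbert_cartan R) 2 u =
     @hilbert_cartan R 2 u + (2 * w 0 4) *: @hilbert_cartan R 1 u).
Proof.
rewrite /pullbacks.
eassert (G : has_gradients (hc_shift w) u _ _ _ _ _) by (rewrite /hc_shift; gradients).
do !split; [pull G (hcE (hc_shift w u)).1.1|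
  pull G (hcE (hc_shift w u)).1.2|
  pull G (hcE (hc_shift w u)).2];
  rewrite !hcE ?(cov5Z, cov5N, cov5D); apply: cov5_eq;
  rewrite /hc_shift !mxE /=; by field.
Qed.

Lemma hc_homogeneous w : locally_equivalent_at (@hilbert_cartan R) w (@hilbert_cartan R) 0.
Proof.
have w0 : hc_shift w 0 = w by apply: vec5_eq; rewrite !mxE; ring.
apply: locally_equivalent_at_sym; rewrite -[in X in locally_equivalent_at _ _ _ X]w0.
apply: (global_equivalence (psi := hc_unshift w)).
- exact: hc_shift_differentiable.
- exact: hc_unshift_differentiable.
- exact: hc_shiftK.
- exact: hc_unshiftK.
apply: span_eq; apply: forall_ord3.
- apply: (@form_span3 _ _ _ _ (fun=> 1) (fun=> 0) (fun=> 0));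
    try holomorphic.
  move=> u _; rewrite !(hc_shift_pull, hcE) !(cov5Z, cov5N, cov5D).
  by apply: cov5_eq; field.
- apply: (@form_span3 _ _ _ _ (fun=> 0) (fun=> 1) (fun=> 0));
    try holomorphic.
  move=> u _; rewrite !(hc_shift_pull, hcE) !(cov5Z, cov5N, cov5D).
  by apply: cov5_eq; field.
- apply: (@form_span3 _ _ _ _ (fun=> 0) (fun=> - (2 * w 0 4)) (fun=> 1));
    try holomorphic.
  move=> u _; rewrite !(hc_shift_pull, hcE) !(cov5Z, cov5N, cov5D).
  by apply: cov5_eq; field.
- apply: (@form_span3 _ _ _ _ (fun=> 1) (fun=> 0) (fun=> 0));
    try holomorphic.
  move=> u _; rewrite !(hc_shift_pull, hcE) !(cov5Z, cov5N, cov5D).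
  by apply: cov5_eq; field.
- apply: (@form_span3 _ _ _ _ (fun=> 0) (fun=> 1) (fun=> 0));
    try holomorphic.
  move=> u _; rewrite !(hc_shift_pull, hcE) !(cov5Z, cov5N, cov5D).
  by apply: cov5_eq; field.
- apply: (@form_span3 _ _ _ _ (fun=> 0) (fun=> 2 * w 0 4) (fun=> 1));
    try holomorphic.
  move=> u _; rewrite !(hc_shift_pull, hcE) !(cov5Z, cov5N, cov5D).
  by apply: cov5_eq; field.
Qed.

(** The third form of the flat Cartan distribution is d(a3 + a4 a5 / 2) - a5 da4, so
    x = a4, q = a5 and p = a3 + a4 a5 / 2; the first gives y = - a1, and the second,
    reduced modulo the third, is half of d(2 a2 + 2 p q - x q^2) - q^2 dx. *)
Definition flat_to_hc (a : C5) : C5 :=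
  let b := a 0 2 + 1 / 2 * a 0 3 * a 0 4 in
  vec5 (a 0 3) (- a 0 0) (2 * a 0 1 + 2 * b * a 0 4 - a 0 3 * a 0 4 ^+ 2) b (a 0 4).
Definition hc_to_flat (u : C5) : C5 :=
  let x := u 0 0 in let y := u 0 1 in let z := u 0 2 in
  let p := u 0 3 in let q := u 0 4 in
  vec5 (- y) (1 / 2 * z - p * q + 1 / 2 * x * q ^+ 2) (p - 1 / 2 * x * q) x q.

Lemma flat_to_hcK : cancel flat_to_hc hc_to_flat.
Proof. by move=> u; apply: vec5_eq; rewrite /flat_to_hc !mxE /=; field. Qed.

Lemma hc_to_flatK : cancel hc_to_flat flat_to_hc.
Proof. by move=> u; apply: vec5_eq; rewrite /hc_to_flat !mxE /=; field. Qed.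

Lemma flat_to_hc_differentiable u : differentiable flat_to_hc u.
Proof. by rewrite /flat_to_hc; cbv zeta; differentiate. Qed.

Lemma hc_to_flat_differentiable u : differentiable hc_to_flat u.
Proof. by rewrite /hc_to_flat; cbv zeta; differentiate. Qed.

Lemma flat_to_hc_pull a :
  (pullbacks flat_to_hc (@hilbert_cartan R) 0 a = - @flat_cartan R 0 a) *
  (pullbacks flat_to_hc (@hilbert_cartan R) 1 a = @flat_cartan R 2 a) *
  (pullbacks flat_to_hc (@hilbert_cartan R) 2 a =
     2 *: @flat_cartan R 1 a + (2 * a 0 4) *: @flat_cartan R 2 a).
Proof.
rewrite /pullbacks.
eassert (G : has_gradients flat_to_hc a _ _ _ _ _) by (rewrite /flat_to_hc; gradients).
do !split; [pull G (hcE (flat_to_hc a)).1.1|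
  pull G (hcE (flat_to_hc a)).1.2|
  pull G (hcE (flat_to_hc a)).2];
  rewrite !flatE ?(cov5Z, cov5N, cov5D); apply: cov5_eq;
  rewrite /flat_to_hc !mxE /=; by field.
Qed.

Lemma flat_cartan_model a : locally_equivalent_at (@flat_cartan R) a (@hilbert_cartan R) 0.
Proof.
apply: (locally_equivalent_at_trans _ (hc_homogeneous (flat_to_hc a))).
apply: (global_equivalence (psi := hc_to_flat)).
- exact: flat_to_hc_differentiable.
- exact: hc_to_flat_differentiable.
- exact: flat_to_hcK.
- exact: hc_to_flatK.
apply: span_eq; apply: forall_ord3.
- apply: (@form_span3 _ _ _ _ (fun=> -1) (fun=> 0) (fun=> 0));
    try holomorphic.
  move=> u _; rewrite !(flat_to_hc_pull, flatE) !(cov5Z, cov5N, cov5D).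
  by apply: cov5_eq; field.
- apply: (@form_span3 _ _ _ _ (fun=> 0) (fun a => - a 0 4) (fun=> 1 / 2));
    try holomorphic.
  move=> u _; rewrite !(flat_to_hc_pull, flatE) !(cov5Z, cov5N, cov5D).
  by apply: cov5_eq; field.
- apply: (@form_span3 _ _ _ _ (fun=> 0) (fun=> 1) (fun=> 0));
    try holomorphic.
  move=> u _; rewrite !(flat_to_hc_pull, flatE) !(cov5Z, cov5N, cov5D).
  by apply: cov5_eq; field.
- apply: (@form_span3 _ _ _ _ (fun=> -1) (fun=> 0) (fun=> 0));
    try holomorphic.
  move=> u _; rewrite !(flat_to_hc_pull, flatE) !(cov5Z, cov5N, cov5D).
  by apply: cov5_eq; field.
- apply: (@form_span3 _ _ _ _ (fun=> 0) (fun=> 0) (fun=> 1));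
    try holomorphic.
  move=> u _; rewrite !(flat_to_hc_pull, flatE) !(cov5Z, cov5N, cov5D).
  by apply: cov5_eq; field.
- apply: (@form_span3 _ _ _ _ (fun=> 0) (fun=> 2) (fun a => 2 * a 0 4));
    try holomorphic.
  move=> u _; rewrite !(flat_to_hc_pull, flatE) !(cov5Z, cov5N, cov5D).
  by apply: cov5_eq; field.
Qed.

Definition Theta_to_flat (c : C5) : C5 :=
  vec5 ((c 0 0 - c 0 2 * c 0 3 - c 0 3 ^+ 2 * c 0 4) / 6)
    ((c 0 1 + c 0 2 * c 0 4 - c 0 3 * c 0 4 ^+ 2) / 6)
    (c 0 2 / 2) (- c 0 3) (c 0 4).
Definition flat_to_Theta (a : C5) : C5 :=
  vec5 (6 * a 0 0 - 2 * a 0 2 * a 0 3 + a 0 3 ^+ 2 * a 0 4)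
    (6 * a 0 1 - 2 * a 0 2 * a 0 4 - a 0 3 * a 0 4 ^+ 2)
    (2 * a 0 2) (- a 0 3) (a 0 4).

Lemma Theta_to_flatK : cancel Theta_to_flat flat_to_Theta.
Proof. by move=> u; apply: vec5_eq; rewrite /Theta_to_flat !mxE /=; field. Qed.

Lemma flat_to_ThetaK : cancel flat_to_Theta Theta_to_flat.
Proof. by move=> u; apply: vec5_eq; rewrite /flat_to_Theta !mxE /=; field. Qed.

Lemma Theta_to_flat_differentiable u : differentiable Theta_to_flat u.
Proof. by rewrite /Theta_to_flat; cbv zeta; differentiate. Qed.

Lemma flat_to_Theta_differentiable u : differentiable flat_to_Theta u.
Proof. by rewrite /flat_to_Theta; cbv zeta; differentiate. Qed.

Lemma Theta_to_flat_pull c :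
  (pullbacks Theta_to_flat (@flat_cartan R) 0 c =
    6^-1 *: (@Theta R 0 c + c 0 3 *: @Theta R 2 c)) *
  (pullbacks Theta_to_flat (@flat_cartan R) 1 c =
    6^-1 *: (@Theta R 1 c - c 0 4 *: @Theta R 2 c)) *
  (pullbacks Theta_to_flat (@flat_cartan R) 2 c = 2^-1 *: @Theta R 2 c).
Proof.
rewrite /pullbacks.
eassert (G : has_gradients Theta_to_flat c _ _ _ _ _)
  by (rewrite /Theta_to_flat; gradients).
do !split; [pull G (flatE (Theta_to_flat c)).1.1|
  pull G (flatE (Theta_to_flat c)).1.2|
  pull G (flatE (Theta_to_flat c)).2];
  rewrite !ThetaE ?(cov5Z, cov5N, cov5D); apply: cov5_eq;
  rewrite /Theta_to_flat !mxE /=; by field.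
Qed.

Lemma Theta_model c : locally_equivalent_at (@Theta R) c (@hilbert_cartan R) 0.
Proof.
apply: (locally_equivalent_at_trans _ (flat_cartan_model (Theta_to_flat c))).
apply: (global_equivalence (psi := flat_to_Theta)).
- exact: Theta_to_flat_differentiable.
- exact: flat_to_Theta_differentiable.
- exact: Theta_to_flatK.
- exact: flat_to_ThetaK.
apply: span_eq; apply: forall_ord3.
- apply: (@form_span3 _ _ _ _ (fun=> 6) (fun=> 0) (fun c => - (2 * c 0 3)));
    try holomorphic.
  move=> u _; rewrite !(Theta_to_flat_pull, ThetaE) !(cov5Z, cov5N, cov5D).
  by apply: cov5_eq; field.
- apply: (@form_span3 _ _ _ _ (fun=> 0) (fun=> 6) (fun c => 2 * c 0 4));
    try holomorphic.
  move=> u _; rewrite !(Theta_to_flat_pull, ThetaE) !(cov5Z, cov5N, cov5D).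
  by apply: cov5_eq; field.
- apply: (@form_span3 _ _ _ _ (fun=> 0) (fun=> 0) (fun=> 2));
    try holomorphic.
  move=> u _; rewrite !(Theta_to_flat_pull, ThetaE) !(cov5Z, cov5N, cov5D).
  by apply: cov5_eq; field.
- apply: (@form_span3 _ _ _ _ (fun=> 6^-1) (fun=> 0) (fun c => c 0 3 / 6));
    try holomorphic.
  move=> u _; rewrite !(Theta_to_flat_pull, ThetaE) !(cov5Z, cov5N, cov5D).
  by apply: cov5_eq; field.
- apply: (@form_span3 _ _ _ _ (fun=> 0) (fun=> 6^-1) (fun c => - (c 0 4 / 6)));
    try holomorphic.
  move=> u _; rewrite !(Theta_to_flat_pull, ThetaE) !(cov5Z, cov5N, cov5D).
  by apply: cov5_eq; field.
- apply: (@form_span3 _ _ _ _ (fun=> 0) (fun=> 0) (fun=> 2^-1));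
    try holomorphic.
  move=> u _; rewrite !(Theta_to_flat_pull, ThetaE) !(cov5Z, cov5N, cov5D).
  by apply: cov5_eq; field.
Qed.
End models.

(** * The chart for alpha = s i / 3 *)

Section third.
Variable R : realType.
Local Notation C := (CC R).
Local Notation C5 := 'rV[C]_5.
Variable s : C.
Hypothesis s2 : s ^+ 2 = 1.
Let i2 : 'i ^+ 2 = -1 :> C := @sqrCi C.
Local Notation j := (s * 'i).

Lemma chart_thirdE : chart_third s = fun u =>
   vec5 (- 2 * (cexp (u 0 2 / 2) * cexp (- (j / 6 * u 0 0)) ^+ 3 * (u 0 1 + j))
         + 8 / 3 * (u 0 4 *
           (j * (cexp (u 0 2 / 2) * cexp (- (j / 6 * u 0 0)) * (u 0 1 - j)))))
   (2 * ((cexp (u 0 2 / 2))^-1 * cexp (- (j / 6 * u 0 0)) ^+ 3 * (1 + (u 0 1 + j) * u 0 3))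
         - 8 / 3 * (u 0 4 *
           (j * ((cexp (u 0 2 / 2))^-1 * cexp (- (j / 6 * u 0 0)) *
             (1 + (u 0 1 - j) * u 0 3)))))
   (2 / 3 * u 0 4)
   (j * (cexp (u 0 2 / 2) * cexp (- (j / 6 * u 0 0)) * (u 0 1 - j)))
   (j * ((cexp (u 0 2 / 2))^-1 * cexp (- (j / 6 * u 0 0)) * (1 + (u 0 1 - j) * u 0 3))).
Proof.
apply/funext => u; rewrite /chart_third.
have -> : cexp (- (j * u 0 0 / 2)) = cexp (- (j / 6 * u 0 0)) ^+ 3.
  by rewrite cexpX; congr cexp; field.
have e6 : - (j * u 0 0 / 6) = - (j / 6 * u 0 0) by rewrite mulrAC.
by rewrite e6 !cexpD (cexpN (u 0 2 / 2)); congr vec5; field; rewrite ?cexp_neq0.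
Qed.

(** Substituting y^2 + 1 = (y + j) (y - j) after subtracting the multiple of omega_2
    that contains dx leaves multiples of s omega_1 + i omega_3; note that
    exp (alpha x) = X^-2. *)
Lemma chart_third_pull (u : C5) :
  let X := cexp (- (j / 6 * u 0 0)) in let E := cexp (u 0 2 / 2) in
  let y := u 0 1 in let p := u 0 3 in let w := rolling (s * ('i / 3)) in
  [/\ pullbacks (chart_third s) (@Theta R) 0 u =
        (E * X ^+ 3 * (s * 'i * (y + s * 'i))) *: w 1 u
        - (E * X ^+ 3 * (y - s * 'i)) *: (s *: w 0 u + 'i *: w 2 u),
      pullbacks (chart_third s) (@Theta R) 1 u =
        (- (X ^+ 3 / E * (s * 'i * (1 + (y + s * 'i) * p)))) *: w 1 u
        + (X ^+ 3 / E * (1 + (y - s * 'i) * p)) *: (s *: w 0 u + 'i *: w 2 u) &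
      pullbacks (chart_third s) (@Theta R) 2 u = X ^+ 2 *: ('i *: w 0 u + s *: w 2 u)].
Proof.
move=> X E y p w.
have e3 : cexp (s * ('i / 3) * u 0 0) = (X ^+ 2)^-1.
  by rewrite /X cexpX -cexpN; congr cexp; field.
have X0 : X != 0 by exact: cexp_neq0.
have E0 : E != 0 by exact: cexp_neq0.
rewrite /w !rollingE e3 /pullbacks chart_thirdE; set phi := (X in pullback X _ _).
eassert (G : has_gradients phi u _ _ _ _ _).
  by rewrite /phi; gradients.
split; [pull G (ThetaE (phi u)).1.1|
  pull G (ThetaE (phi u)).1.2|
  pull G (ThetaE (phi u)).2].
all: rewrite /phi !mxE /= ?(cov5Z, cov5N, cov5D) -/X -/E -/y -/p.
all: apply: cov5_eq.
all: clear G.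
all: by field: s2 i2; rewrite ?X0 ?E0.
Qed.

Lemma chart_third_differentiable u : differentiable (chart_third s) u.
Proof. by rewrite chart_thirdE; differentiate. Qed.

(** A and B are the entries E X^3 (y + j) and X^3 / E (1 + (y + j) p), while - j c_4
    and - j c_5 are C = E X (y - j) and D = X / E (1 + (y - j) p).  Then [third_W] is
    (A D - B C) / (2 j) = X^4; its logarithm is taken near t0, and E and p come
    from A / X^3 - C / X = 2 j E and B / X^3 - D / X = 2 j p / E. *)
Local Notation A c := (- ((c 0 0 - 4 * (c 0 2 * c 0 3)) / 2)).
Local Notation B c := ((c 0 1 + 4 * (c 0 2 * c 0 4)) / 2).

Definition third_W (c : C5) : C := 2^-1 * (B c * c 0 3 - A c * c 0 4).
Definition third_log t0 (c : C5) : C := t0 + clog (third_W c * cexp (- t0)).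
Definition third_E t0 (c : C5) : C :=
  let X := cexp (third_log t0 c / 4) in
  - (j / 2) * (A c * X^-1 ^+ 3 + j * c 0 3 * X^-1).
Definition third_inv t0 z0 (c : C5) : C5 :=
  let X := cexp (third_log t0 c / 4) in
  let E := third_E t0 c in
  vec5 (3 / 2 * j * third_log t0 c) (A c * X^-1 ^+ 3 * E^-1 - j)
    (2 * (z0 + clog (E * cexp (- z0))))
    (- (j / 2) * (B c * X^-1 ^+ 3 + j * c 0 4 * X^-1) * E)
    (3 / 2 * c 0 2).

Lemma third_W_chart u : third_W (chart_third s u) = cexp (- (2 / 3 * j * u 0 0)).
Proof.
have -> : cexp (- (2 / 3 * j * u 0 0)) = cexp (- (j / 6 * u 0 0)) ^+ 4.
  by rewrite cexpX; congr cexp; field.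
rewrite chart_thirdE /third_W !mxE /=.
by field: s2 i2; rewrite ?cexp_neq0.
Qed.

Lemma third_E_chart t0 u : third_log t0 (chart_third s u) = - (2 / 3 * j * u 0 0) ->
  third_E t0 (chart_third s u) = cexp (u 0 2 / 2).
Proof.
rewrite /third_E => ->.
have -> : - (2 / 3 * j * u 0 0) / 4 = - (j / 6 * u 0 0) by field.
rewrite chart_thirdE !mxE /=.
by field: s2 i2; rewrite ?cexp_neq0.
Qed.

Lemma third_log_chart t0 (u : C5) (t := - (2 / 3 * j * u 0 0)) :
   - (pi / 2) < complex.Im (t - t0) < pi / 2 ->
   third_log t0 (chart_third s u) = t.
Proof.
by move=> ht; rewrite /third_log third_W_chart -cexpD cexpK// addrC subrK.
Qed.

Lemma third_invK t0 z0 (u : C5) (t := - (2 / 3 * j * u 0 0)) :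
  - (pi / 2) < complex.Im (t - t0) < pi / 2 ->
  - (pi / 2) < complex.Im (u 0 2 / 2 - z0) < pi / 2 ->
  third_inv t0 z0 (chart_third s u) = u.
Proof.
move=> ht hz; have tE := third_log_chart ht.
rewrite /third_inv (third_E_chart tE) tE -cexpD cexpK//.
have -> : t / 4 = - (j / 6 * u 0 0) by rewrite /t; field.
rewrite chart_thirdE !mxE /=.
by apply: vec5_eq; rewrite /t; field: s2 i2; rewrite ?cexp_neq0.
Qed.

Lemma chart_third_inv t0 z0 (c : C5) :
  0 < complex.Re (third_W c * cexp (- t0)) ->
  0 < complex.Re (third_E t0 c * cexp (- z0)) ->
  chart_third s (third_inv t0 z0 c) = c.
Proof.
move=> hW hE.
have E0 : third_E t0 c != 0.
  by apply: contraTneq hE => ->; rewrite mul0r ltxx.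
have X0 : cexp (third_log t0 c / 4) != 0 by exact: cexp_neq0.
have EE : cexp (z0 + clog (third_E t0 c * cexp (- z0))) = third_E t0 c.
  by rewrite cexpD clogK// mulrCA -cexpD subrr cexp0 mulr1.
have XE : cexp (third_log t0 c / 4) ^+ 4 = third_W c.
  rewrite cexpX (_ : _ *+ 4 = third_log t0 c); last by rewrite -mulr_natr; field.
  by rewrite /third_log cexpD clogK// mulrCA -cexpD subrr cexp0 mulr1.
rewrite chart_thirdE /third_inv !mxE /=.
have -> : 2 * (z0 + clog (third_E t0 c * cexp (- z0))) / 2 =
    z0 + clog (third_E t0 c * cexp (- z0)).
  by field.
have -> : - (j / 6 * (3 / 2 * j * third_log t0 c)) = third_log t0 c / 4 by field: s2 i2.
rewrite EE; set X := cexp (third_log t0 c / 4) in X0 XE *.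
(* The definition of E is solved for A, hence for c_1, so that E becomes a free
   variable; the equation for X^4 is used as a rule for the product c_2 c_4. *)
have cE : c 0 0 = - 2 * (2 * j * third_E t0 c * X ^+ 3 - j * c 0 3 * X ^+ 2)
    + 4 * (c 0 2 * c 0 3).
  by rewrite /third_E -/X; field: s2 i2.
rewrite /third_W in XE.
set E := third_E t0 c in E0 cE *.
rewrite cE in XE *.
have {}XE : c 0 1 * c 0 3 = 4 * X ^+ 4
    + 2 * (2 * j * E * X ^+ 3 - j * c 0 3 * X ^+ 2) * c 0 4 - 4 * c 0 2 * c 0 4 * c 0 3.
  by rewrite XE; field.
apply: vec5_eq; rewrite ?cE.
all: by field: s2 i2 XE; rewrite ?X0 ?E0.
Qed.

Lemma chart_third_local : local_coordinates setT (chart_third s).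
Proof.
move=> u0 _; pose t0 := - (2 / 3 * j * u0 0 0); pose z0 := u0 0 2 / 2.
have p0 : - (pi / 2) < complex.Im (t0 - t0) < pi / 2.
  by rewrite subrr /= oppr_lt0 divr_gt0 ?pi_gt0.
pose v0 := chart_third s u0.
have W1 : third_W v0 * cexp (- t0) = 1.
  by rewrite third_W_chart -cexpD -/t0 subrr cexp0.
have E1 : third_E t0 v0 * cexp (- z0) = 1.
  by rewrite (third_E_chart (third_log_chart p0)) -cexpD subrr cexp0.
have dW v : differentiable (fun v => third_W v * cexp (- t0)) v.
  by rewrite /third_W; differentiate.
have dE v : 0 < complex.Re (third_W v * cexp (- t0)) ->
    differentiable (fun v => third_E t0 v * cexp (- z0)) v.
  by move=> hW; rewrite /third_E /third_log /third_W; differentiate; exact: hW.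
have dI v : 0 < complex.Re (third_W v * cexp (- t0)) ->
    0 < complex.Re (third_E t0 v * cexp (- z0)) -> differentiable (third_inv t0 z0) v.
  move=> hW hE; have E0 : third_E t0 v != 0.
    by apply: contraTneq hE => ->; rewrite mul0r ltxx.
  rewrite /third_inv /third_E /third_log /third_W; cbv zeta.
  by differentiate; first [exact: hW|exact: hE|exact: E0].
have NW : \forall v \near v0, 0 < complex.Re (third_W v * cexp (- t0)).
  exact: (near_right (differentiable_continuous (dW v0)) W1).
have NE : \forall v \near v0, 0 < complex.Re (third_E t0 v * cexp (- z0)).
  apply: (near_right (differentiable_continuous (dE v0 _)) E1).
  by rewrite W1 ltr01.
apply: (@biholomorphic_germ _ _ (third_inv t0 z0) u0 v0 _ _ _ _ _ setT openT) => //.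
- by near=> u; exact: chart_third_differentiable.
- by apply: filterS2 NW NE => v; exact: dI.
- have N1 : \forall u \near u0, - (pi / 2) <
      complex.Im (- (2 / 3 * j * (u : C5) 0 0) - t0) < pi / 2.
    apply: near_strip; last by rewrite subrr.
    by apply: differentiable_continuous; differentiate.
  have N2 : \forall u \near u0, - (pi / 2) < complex.Im ((u : C5) 0 2 / 2 - z0) < pi / 2.
    apply: near_strip; last by rewrite subrr.
    by apply: differentiable_continuous; differentiate.
  by apply: filterS2 N1 N2 => u; exact: third_invK.
- by apply: filterS2 NW NE => v; exact: chart_third_inv.
Unshelve. all: by end_near. Qed.

(** The coefficients of omega_1, omega_2, omega_3 in terms of the pulled back forms
    come from the determinant
    (y + j) (1 + (y - j) p) - (y - j) (1 + (y + j) p) = 2 j. *)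
Lemma chart_third_span :
  form_span setT (pullbacks (chart_third s) (@Theta R)) =
  form_span setT (rolling (s * ('i / 3))).
Proof.
pose X (u : C5) := cexp (- (j / 6 * u 0 0)); pose E (u : C5) := cexp (u 0 2 / 2).
apply: span_eq; apply: forall_ord3.
- apply: (@form_span3 _ _ _ _ (fun u => - (s * (E u * X u ^+ 3 * (u 0 1 - j))))
    (fun u => j * (E u * X u ^+ 3 * (u 0 1 + j)))
    (fun u => - ('i * (E u * X u ^+ 3 * (u 0 1 - j)))));
    rewrite /E /X; try holomorphic.
  move=> u _; have [-> _ _] := chart_third_pull u; rewrite -/(E u) -/(X u).
  by rewrite !rollingE !(cov5Z, cov5N, cov5D);
    apply: cov5_eq; field: s2 i2.
- apply: (@form_span3 _ _ _ _
    (fun u => s * (X u ^+ 3 * (E u)^-1 * (1 + (u 0 1 - j) * u 0 3)))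
    (fun u => - (j * (X u ^+ 3 * (E u)^-1 * (1 + (u 0 1 + j) * u 0 3))))
    (fun u => 'i * (X u ^+ 3 * (E u)^-1 * (1 + (u 0 1 - j) * u 0 3))));
    rewrite /E /X; try holomorphic.
  move=> u _; have [_ -> _] := chart_third_pull u; rewrite -/(E u) -/(X u).
  have E0 : E u != 0 by exact: cexp_neq0.
  by rewrite !rollingE !(cov5Z, cov5N, cov5D);
    apply: cov5_eq; field: s2 i2; rewrite ?E0.
- apply: (@form_span3 _ _ _ _ (fun u => 'i * X u ^+ 2) (fun=> 0) (fun u => s * X u ^+ 2));
    rewrite /X; try holomorphic.
  move=> u _; have [_ _ ->] := chart_third_pull u; rewrite -/(X u).
  by rewrite !rollingE !(cov5Z, cov5N, cov5D);
    apply: cov5_eq; field: s2 i2.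
- apply: (@form_span3 _ _ _ _
    (fun u => - (2^-1 * (s * (j / 2 *
      ((1 + (u 0 1 + j) * u 0 3) * ((X u)^-1 ^+ 3 * (E u)^-1))))))
    (fun u => - (2^-1 * (s * (j / 2 * ((u 0 1 + j) * ((X u)^-1 ^+ 3 * E u))))))
    (fun u => - ('i / 2 * (X u)^-1 ^+ 2)));
    rewrite /E /X; try holomorphic.
  move=> u _; have [-> -> ->] := chart_third_pull u; rewrite -/(E u) -/(X u).
  have E0 : E u != 0 by exact: cexp_neq0.
  have X0 : X u != 0 by exact: cexp_neq0.
  by rewrite !rollingE !(cov5Z, cov5N, cov5D);
    apply: cov5_eq; field: s2 i2; rewrite ?X0 ?E0.
- apply: (@form_span3 _ _ _ _
    (fun u => - (2^-1 * ((1 + (u 0 1 - j) * u 0 3) * ((X u)^-1 ^+ 3 * (E u)^-1))))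
    (fun u => - (2^-1 * ((u 0 1 - j) * ((X u)^-1 ^+ 3 * E u))))
    (fun=> 0));
    rewrite /E /X; try holomorphic.
  move=> u _; have [-> -> ->] := chart_third_pull u; rewrite -/(E u) -/(X u).
  have E0 : E u != 0 by exact: cexp_neq0.
  have X0 : X u != 0 by exact: cexp_neq0.
  by rewrite !rollingE !(cov5Z, cov5N, cov5D);
    apply: cov5_eq; field: s2 i2; rewrite ?X0 ?E0.
- apply: (@form_span3 _ _ _ _
    (fun u => 'i / 2 * (j / 2 * ((1 + (u 0 1 + j) * u 0 3) * ((X u)^-1 ^+ 3 * (E u)^-1))))
    (fun u => 'i / 2 * (j / 2 * ((u 0 1 + j) * ((X u)^-1 ^+ 3 * E u))))
    (fun u => s / 2 * (X u)^-1 ^+ 2));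
    rewrite /E /X; try holomorphic.
  move=> u _; have [-> -> ->] := chart_third_pull u; rewrite -/(E u) -/(X u).
  have E0 : E u != 0 by exact: cexp_neq0.
  have X0 : X u != 0 by exact: cexp_neq0.
  by rewrite !rollingE !(cov5Z, cov5N, cov5D);
    apply: cov5_eq; field: s2 i2; rewrite ?X0 ?E0.
Qed.
End third.

(** * The chart for alpha = 3 s i *)

Section three.
Variable R : realType.
Local Notation C := (CC R).
Local Notation C5 := 'rV[C]_5.
Variable s : C.
Hypothesis s2 : s ^+ 2 = 1.
Let i2 : 'i ^+ 2 = -1 :> C := @sqrCi C.
Local Notation j := (s * 'i).
Local Notation E u := (cexp (u 0 2 / 2)).
Local Notation X u := (cexp (3 / 2 * j * u 0 0)).
Local Notation y u := (u 0 1).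
Local Notation p u := (u 0 3).
Local Notation q u := (u 0 4).
Lemma chart_threeE : chart_three s = fun u =>
   vec5 (16 / 3 * ((y u)^-1 ^+ 2 * (E u)^-1 ^+ 3 * X u *
     (2 * y u * (y u - j) * p u + 1 / 4 * (5 * y u - 3 * j))))
   (16 / 3 * ((y u)^-1 ^+ 2 * (E u)^-1 ^+ 3 * (q u * X u *
       (2 * y u * (y u - j) * p u + 1 / 4 * (5 * y u - 3 * j))
     + j / 3 * (X u)^-1 * (2 * y u * (y u + j) * p u + 1 / 4 * (5 * y u + 3 * j)))))
   (- (4 / 3) * ((y u)^-1 * (E u)^-1 ^+ 2 * (2 * p u * y u + 1)))
   (- ((y u)^-1 * (E u)^-1 * X u * (y u - j)))
   ((y u)^-1 * (E u)^-1 * (q u * X u * (y u - j) + j / 3 * (X u)^-1 * (y u + j))).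
Proof.
apply/funext => u; rewrite /chart_three.
have e1 : 3 * j * u 0 0 / 2 = 3 / 2 * j * u 0 0 by field.
have e2 : cexp (- (3 * u 0 2 / 2)) = (E u)^-1 ^+ 3.
  by rewrite cexpN exprVn cexpX; congr (cexp _)^-1; field.
have e3 : cexp (- u 0 2) = (E u)^-1 ^+ 2.
  by rewrite cexpN exprVn cexpX; congr (cexp _)^-1; field.
rewrite e1 !cexpD e2 e3 !cexpN !invfM.
by congr vec5; rewrite -?exprVn; ring.
Qed.

(** Here exp (alpha x) = X^2.  After q times the first form is subtracted, the second
    has j/3 times the coefficients of the first with s replaced by - s and X by 1 / X. *)
Lemma chart_three_pull (u : C5) : y u != 0 -> let w := rolling (s * (3 * 'i)) in
  let K := 4 / 3 * (X u * (y u)^-1 ^+ 2 * (E u)^-1 ^+ 3) in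
  let L := 4 / 9 * j * ((X u)^-1 * (y u)^-1 ^+ 2 * (E u)^-1 ^+ 3) in
  [/\ pullbacks (chart_three s) (@Theta R) 0 u =
        (K * (3 / 2 * j) * (y u + j)) *: w 1 u
        + (K / 2 * (y u - j)) *: ('i *: w 2 u - (3 * s) *: w 0 u),
      pullbacks (chart_three s) (@Theta R) 1 u =
        q u *: pullbacks (chart_three s) (@Theta R) 0 u
        - (L * (3 / 2 * j) * (y u - j)) *: w 1 u
        + (L / 2 * (y u + j)) *: ('i *: w 2 u + (3 * s) *: w 0 u) &
      pullbacks (chart_three s) (@Theta R) 2 u =
        ((y u)^-1 ^+ 2 * (E u)^-1 ^+ 2) *:
          ((y u ^+ 2 + 1) *: w 1 u + ('i * (y u ^+ 2 - 1)) *: w 0 u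
           + (2 / 3 * 'i * y u) *: w 2 u)].
Proof.
move=> y0 w K L; rewrite {}/K {}/L.
have e3 : cexp (s * (3 * 'i) * u 0 0) = X u ^+ 2.
  by rewrite cexpX; congr cexp; field.
have X0 : X u != 0 by exact: cexp_neq0.
have E0 : E u != 0 by exact: cexp_neq0.
rewrite /w !rollingE e3 /pullbacks chart_threeE; set phi := (X in pullback X _ _).
eassert (G : has_gradients phi u _ _ _ _ _).
  by rewrite /phi; gradients; exact: y0.
split; [pull G (ThetaE (phi u)).1.1|
  pull G (ThetaE (phi u)).1.2; pull G (ThetaE (phi u)).1.1|
  pull G (ThetaE (phi u)).2].
all: rewrite /phi !mxE /= ?(cov5Z, cov5N, cov5D).
all: move: X0 E0; set E := cexp (u 0 2 / 2); set X := cexp _ => X0 E0.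
all: apply: cov5_eq.
all: clear G.
all: by field: s2 i2; rewrite ?X0 ?E0 ?y0.
Qed.
End three.

Section three_span.
Variable R : realType.
Local Notation C := (CC R).
Local Notation C5 := 'rV[C]_5.
Variable s : C.
Hypothesis s2 : s ^+ 2 = 1.
Let i2 : 'i ^+ 2 = -1 :> C := @sqrCi C.
Local Notation j := (s * 'i).
Local Notation E u := (cexp (u 0 2 / 2)).
Local Notation X u := (cexp (3 / 2 * j * u 0 0)).
Local Notation y u := (u 0 1).
Local Notation p u := (u 0 3).
Local Notation q u := (u 0 4).
Local Notation K u := (4 / 3 * (X u * (y u)^-1 ^+ 2 * (E u)^-1 ^+ 3)).
Local Notation L u := (4 / 9 * j * ((X u)^-1 * (y u)^-1 ^+ 2 * (E u)^-1 ^+ 3)).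
Local Notation K' u := (3 / 4 * ((X u)^-1 * y u ^+ 2 * E u ^+ 3)).
Local Notation L' u := (- (9 / 4 * j) * (X u * y u ^+ 2 * E u ^+ 3)).
Local Notation N' u := (y u ^+ 2 * E u ^+ 2).
Local Notation a1 u := (j / 4 * ((y u - j) * (y u)^-1)).
Local Notation a2 u := (- (j / 4) * ((y u + j) * (y u)^-1)).
Local Notation a3 u := (3 / 4 * (y u)^-1).

(** K' u, L' u and N' u invert the scalar factors of the three pulled back forms, after
    q times the first is subtracted from the second.  Call the normalized forms M1,
    M2, M3; then a1 M1 + a2 M2 + a3 M3 = i omega_3, because
    M3 - (j/3) ((y + j) M2 - (y - j) M1) = (4/3) y i omega_3, and omega_1 and omega_2
    are then obtained from M1 and M2, where the determinant (y + j)^2 - (y - j)^2 is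
    4 j y. *)
Lemma chart_three_span (D := [set u : C5 | y u != 0]) :
  form_span D (pullbacks (chart_three s) (@Theta R)) =
  form_span D (rolling (s * (3 * 'i))).
Proof.
apply: span_eq; apply: forall_ord3.
- apply: (@form_span3 _ _ _ _ (fun u => - (3 * s) * (K u / 2 * (y u - j)))
    (fun u => K u * (3 / 2 * j) * (y u + j))
    (fun u => 'i * (K u / 2 * (y u - j)))) => u /= yu;
    first [by differentiate|idtac].
  have [-> _ _] := chart_three_pull s2 yu.
  by rewrite !rollingE !(cov5Z, cov5N, cov5D); apply: cov5_eq; ring.
- apply: (@form_span3 _ _ _ _
    (fun u => 3 * s * (L u / 2 * (y u + j)) - q u * (3 * s * (K u / 2 * (y u - j))))
    (fun u => q u * (K u * (3 / 2 * j) * (y u + j)) - L u * (3 / 2 * j) * (y u - j))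
    (fun u => 'i * (L u / 2 * (y u + j) + q u * (K u / 2 * (y u - j))))) => u /= yu;
    first [by differentiate|idtac].
  have [+ -> _] := chart_three_pull s2 yu => ->.
  by rewrite !rollingE !(cov5Z, cov5N, cov5D); apply: cov5_eq; ring.
- apply: (@form_span3 _ _ _ _
    (fun u => 'i * ((y u)^-1 ^+ 2 * (E u)^-1 ^+ 2 * (y u ^+ 2 - 1)))
    (fun u => (y u)^-1 ^+ 2 * (E u)^-1 ^+ 2 * (y u ^+ 2 + 1))
    (fun u => 2 / 3 * 'i * ((y u)^-1 ^+ 2 * (E u)^-1 ^+ 2 * y u))) => u /= yu;
    first [by differentiate|idtac].
  have [_ _ ->] := chart_three_pull s2 yu.
  by rewrite !rollingE !(cov5Z, cov5N, cov5D); apply: cov5_eq; ring.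
- apply: (@form_span3 _ _ _ _
    (fun u => - ('i / 6) * ((y u)^-1 * ((y u - j - (y u ^+ 2 - 1) * a1 u) * K' u
        - (y u + j - (y u ^+ 2 - 1) * a2 u) * (L' u * q u))))
    (fun u => - ('i / 6) * ((y u)^-1 * ((y u + j - (y u ^+ 2 - 1) * a2 u) * L' u)))
    (fun u => 'i / 6 * ((y u)^-1 * ((y u ^+ 2 - 1) * a3 u * N' u)))) => u /= yu;
    first [by differentiate|idtac].
  have [+ -> ->] := chart_three_pull s2 yu => ->.
  have E0 := cexp_neq0 (u 0 2 / 2); have X0 := cexp_neq0 (3 / 2 * j * u 0 0).
  rewrite !rollingE !(cov5Z, cov5N, cov5D);
    by apply: cov5_eq; field: s2 i2; rewrite ?yu ?X0 ?E0.
- apply: (@form_span3 _ _ _ _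
    (fun u => - (1 / 6) * ((y u)^-1 * ((y u + j - (y u ^+ 2 + 1) * a1 u) * K' u
        - (y u - j - (y u ^+ 2 + 1) * a2 u) * (L' u * q u))))
    (fun u => - (1 / 6) * ((y u)^-1 * ((y u - j - (y u ^+ 2 + 1) * a2 u) * L' u)))
    (fun u => 1 / 6 * ((y u)^-1 * ((y u ^+ 2 + 1) * a3 u * N' u)))) => u /= yu;
    first [by differentiate|idtac].
  have [+ -> ->] := chart_three_pull s2 yu => ->.
  have E0 := cexp_neq0 (u 0 2 / 2); have X0 := cexp_neq0 (3 / 2 * j * u 0 0).
  rewrite !rollingE !(cov5Z, cov5N, cov5D);
    by apply: cov5_eq; field: s2 i2; rewrite ?yu ?X0 ?E0.
- apply: (@form_span3 _ _ _ _
    (fun u => - 'i * (a1 u * K' u - a2 u * (L' u * q u)))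
    (fun u => - 'i * (a2 u * L' u))
    (fun u => - 'i * (a3 u * N' u))) => u /= yu;
    first [by differentiate|idtac].
  have [+ -> ->] := chart_three_pull s2 yu => ->.
  have E0 := cexp_neq0 (u 0 2 / 2); have X0 := cexp_neq0 (3 / 2 * j * u 0 0).
  rewrite !rollingE !(cov5Z, cov5N, cov5D);
    by apply: cov5_eq; field: s2 i2; rewrite ?yu ?X0 ?E0.
Qed.
End three_span.

Section three_inverse.
Variable R : realType.
Local Notation C := (CC R).
Local Notation C5 := 'rV[C]_5.
Variable s : C.
Hypothesis s2 : s ^+ 2 = 1.
Let i2 : 'i ^+ 2 = -1 :> C := @sqrCi C.
Local Notation j := (s * 'i).
Local Notation E u := (cexp (u 0 2 / 2)).
Local Notation X u := (cexp (3 / 2 * j * u 0 0)).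
Local Notation y u := (u 0 1).
Local Notation p u := (u 0 3).
Local Notation q u := (u 0 4).

(** The functions below recover, near the image of a point, the quantities
    g = y E^2, a = E X (y + j), b = E X (y - j), M = E X, F = E^2 = exp z, X, and the
    coordinates.  The input is [three_W] = g^-2, whose square root near g0^-2 is taken
    as exp (log (g0^2 W) / 2) / g0; z0 and x0 fix the branches of the logarithms that
    give z and 3 j x / 2. *)
Local Notation P c := (c 0 0 - 4 * (c 0 2 * c 0 3)).
Local Notation Q c := (c 0 1 + 4 * (c 0 2 * c 0 4)).
Definition three_W (c : C5) : C := - (9 / 16) * (Q c * c 0 3 + P c * c 0 4).
Definition three_g g0 (c : C5) : C := g0 * cexp (- (clog (three_W c * g0 ^+ 2) / 2)).
Definition three_a g0 (c : C5) : C := 3 / 4 * (P c * three_g g0 c ^+ 2).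
Definition three_b g0 (c : C5) : C := - (three_g g0 c * c 0 3).
Definition three_M g0 (c : C5) : C := - (j / 2) * (three_a g0 c - three_b g0 c).
Definition three_F g0 (c : C5) : C :=
  2 * (three_g g0 c * three_M g0 c * (three_a g0 c + three_b g0 c)^-1).
Definition three_z g0 z0 (c : C5) : C := z0 + clog (three_F g0 c * cexp (- z0)).
Definition three_X g0 z0 (c : C5) : C := three_M g0 c * cexp (- (three_z g0 z0 c / 2)).
Definition three_x g0 z0 x0 (c : C5) : C := x0 + clog (three_X g0 z0 c * cexp (- x0)).
Definition three_y g0 (c : C5) : C :=
  2^-1 * ((three_a g0 c + three_b g0 c) * (three_M g0 c)^-1).
Definition three_inv g0 z0 x0 (c : C5) : C5 :=
  vec5 (- (2 / 3 * j * three_x g0 z0 x0 c)) (three_y g0 c) (three_z g0 z0 c)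
    (- (2^-1 * ((3 / 4 * (c 0 2 * three_g g0 c) + 1) * (three_y g0 c)^-1)))
    (- (j / 2) * ((3 / 4 * (three_g g0 c ^+ 2 * Q c) - three_g g0 c * c 0 4
      - 2 / 3 * (three_F g0 c * (three_M g0 c)^-1)) * (three_M g0 c)^-1)).

Lemma three_W_chart (u : C5) : y u != 0 ->
  three_W (chart_three s u) = (y u * E u ^+ 2)^-1 ^+ 2.
Proof.
move=> y0; rewrite chart_threeE /three_W !mxE /=.
by field: s2 i2; rewrite ?cexp_neq0 ?y0.
Qed.

Lemma three_g_chart g0 (u : C5) (r := g0 * (y u * E u ^+ 2)^-1) : y u != 0 -> g0 != 0 ->
  0 < complex.Re r -> - (pi / 2) < complex.Im (2 * clog r) < pi / 2 ->
  three_g g0 (chart_three s u) = y u * E u ^+ 2.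
Proof.
move=> y0 g00 r0 hr; rewrite /three_g three_W_chart// mulrC.
have -> : (y u * E u ^+ 2)^-1 ^+ 2 * g0 ^+ 2 = cexp (2 * clog r).
  by rewrite mulr_natl -cexpX clogK// /r -exprMn mulrC.
rewrite cexpK// (_ : 2 * clog r / 2 = clog r); last by field.
rewrite cexpN clogK// /r.
by field; rewrite ?cexp_neq0 ?y0 ?g00.
Qed.

Section chart_values.
Variables (g0 : C) (u : C5).
Hypothesis y0 : y u != 0.
Hypothesis gE : three_g g0 (chart_three s u) = y u * E u ^+ 2.

Lemma three_a_chart : three_a g0 (chart_three s u) = E u * X u * (y u + j).
Proof.
rewrite /three_a gE chart_threeE !mxE /=.
by field: s2 i2; rewrite ?cexp_neq0 ?y0.
Qed.
Lemma three_b_chart : three_b g0 (chart_three s u) = E u * X u * (y u - j).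
Proof.
rewrite /three_b gE chart_threeE !mxE /=.
by field: s2 i2; rewrite ?cexp_neq0 ?y0.
Qed.
Lemma three_M_chart : three_M g0 (chart_three s u) = E u * X u.
Proof. by rewrite /three_M three_a_chart three_b_chart; field: s2 i2. Qed.
Lemma three_F_chart : three_F g0 (chart_three s u) = cexp (u 0 2).
Proof.
have -> : cexp (u 0 2) = E u ^+ 2 by rewrite cexpX; congr cexp; field.
rewrite /three_F gE three_M_chart three_a_chart three_b_chart.
rewrite -mulrDr addrACA subrr addr0.
by field; rewrite ?cexp_neq0 ?y0 -mulr2n mulrn_eq0 ?y0.
Qed.
Lemma three_y_chart : three_y g0 (chart_three s u) = y u.
Proof.
rewrite /three_y three_M_chart three_a_chart three_b_chart.
by field; rewrite ?cexp_neq0.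
Qed.
Lemma three_invK z0 x0 :
  - (pi / 2) < complex.Im (u 0 2 - z0) < pi / 2 ->
  - (pi / 2) < complex.Im (3 / 2 * j * u 0 0 - x0) < pi / 2 ->
  three_inv g0 z0 x0 (chart_three s u) = u.
Proof.
move=> hz hx.
have zE : three_z g0 z0 (chart_three s u) = u 0 2.
  by rewrite /three_z three_F_chart -cexpD cexpK// addrC subrK.
have xE : three_x g0 z0 x0 (chart_three s u) = 3 / 2 * j * u 0 0.
  have XE : three_X g0 z0 (chart_three s u) = X u.
    by rewrite /three_X three_M_chart zE (cexpN (u 0 2 / 2)); field; rewrite ?cexp_neq0.
  by rewrite /three_x XE -cexpD cexpK// addrC subrK.
rewrite /three_inv zE xE three_y_chart gE three_F_chart three_M_chart.
have -> : cexp (u 0 2) = E u ^+ 2 by rewrite cexpX; congr cexp; field.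
rewrite chart_threeE !mxE /=.
by apply: vec5_eq; field: s2 i2; rewrite ?cexp_neq0 ?y0.
Qed.
End chart_values.

Lemma chart_three_inv g0 z0 x0 (c : C5) : g0 != 0 ->
  0 < complex.Re (three_W c * g0 ^+ 2) ->
  0 < complex.Re (three_F g0 c * cexp (- z0)) ->
  0 < complex.Re (three_X g0 z0 c * cexp (- x0)) ->
  chart_three s (three_inv g0 z0 x0 c) = c.
Proof.
move=> g00 hW hF hX.
have [hF0 hX0] := (Re_neq0 hF, Re_neq0 hX).
have F0 : three_F g0 c != 0 by apply: contraNneq hF0 => ->; rewrite mul0r.
have M0 : three_M g0 c != 0.
  by apply: contraNneq F0; rewrite /three_F => ->; rewrite mulr0 mul0r mulr0.
have ab0 : three_a g0 c + three_b g0 c != 0.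
  by apply: contraNneq F0; rewrite /three_F => ->; rewrite invr0 !mulr0.
have gn0 : three_g g0 c != 0.
  by apply: contraNneq F0; rewrite /three_F => ->; rewrite !mul0r mulr0.
have W0 : three_W c != 0.
  by apply: contraNneq (Re_neq0 hW) => ->; rewrite mul0r.
have gW : three_g g0 c ^+ 2 * three_W c = 1.
  rewrite /three_g exprMn cexpX.
  rewrite (_ : _ *+ 2 = - clog (three_W c * g0 ^+ 2)); last by rewrite -mulr_natr; field.
  rewrite cexpN clogK//.
  by field; rewrite ?g00 ?W0.
have cz : cexp (three_z g0 z0 c) = three_F g0 c.
  by rewrite /three_z cexpD clogK// mulrCA -cexpD subrr cexp0 mulr1.
have cx : cexp (three_x g0 z0 x0 c) = three_X g0 z0 c.
  by rewrite /three_x cexpD clogK// mulrCA -cexpD subrr cexp0 mulr1.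
rewrite chart_threeE /three_inv !mxE /=.
have -> : 3 / 2 * j * - (2 / 3 * j * three_x g0 z0 x0 c) = three_x g0 z0 x0 c.
  by field: s2 i2.
rewrite cx /three_X cexpN.
have E2 : cexp (three_z g0 z0 c / 2) ^+ 2 = three_F g0 c.
  by rewrite cexpX -cz; congr cexp; rewrite -mulr_natr; field.
have E0 := cexp_neq0 (three_z g0 z0 c / 2).
set E := cexp _ in E2 E0 *.
have y0 : three_y g0 c != 0.
  by rewrite /three_y mulf_neq0 ?mulf_neq0 ?invr_neq0 ?pnatr_eq0.
have FE : three_F g0 c = three_g g0 c / three_y g0 c.
  by rewrite /three_F /three_y; field; rewrite ?M0 ?ab0.
have yM : three_M g0 c * three_y g0 c = 2^-1 * (three_a g0 c + three_b g0 c).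
  by rewrite /three_y; field.
have aE : three_a g0 c = three_M g0 c * (three_y g0 c + j).
  by rewrite mulrDr yM /three_M; field: s2 i2.
have bE : three_b g0 c = three_M g0 c * (three_y g0 c - j).
  by rewrite mulrBr yM /three_M; field: s2 i2.
rewrite /three_a in aE; rewrite /three_b in bE; rewrite FE in E2 *.
move: gW gn0 y0 M0 aE bE E2; rewrite /three_W.
set g := three_g g0 c; set yy := three_y g0 c; set M := three_M g0 c.
move=> gW gn0 y0 M0 aE bE E2.
(* All c_k are expressed through g, y, M, E, c_3 and the last coordinate q: c_4 and
   c_1 from b and a, then c_2 from the formula for q, and c_5 from g^2 W = 1. *)
have gE : g = yy * E ^+ 2 by rewrite E2; field.
have c3E : c 0 3 = - (M * (yy - j) / g) by rewrite -bE; field.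
have c0E : c 0 0 = 4 / 3 * (M * (yy + j) / g ^+ 2) + 4 * (c 0 2 * c 0 3).
  by rewrite -aE; field.
set qq := - (j / 2) * _.
have c1E : c 0 1 = 4 / 3 * ((2 * j * M * qq + g * c 0 4 + 2 / 3 * (g / yy / M)) / g ^+ 2)
    - 4 * (c 0 2 * c 0 4).
  by rewrite /qq; field: s2 i2; rewrite ?gn0 ?y0 ?M0.
have c4E : c 0 4 = j / 3 * (yy + j) / (yy * M) + M * (yy - j) * qq / g.
  apply/eqP; rewrite -subr_eq0; apply/eqP.
  transitivity (2 / 3 * j / M * (g ^+ 2 * three_W c - 1)); last by rewrite gW subrr mulr0.
  rewrite /three_W c1E c0E c3E.
  by field: s2 i2; rewrite ?gn0 ?y0 ?M0.
clearbody qq; rewrite c4E c3E in c0E c1E *.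
apply: vec5_eq; rewrite ?c0E ?c1E ?c3E ?c4E ?gE.
all: by field: s2 i2; rewrite ?y0 ?M0 ?E0.
Qed.

Section differentiability.
Variables (g0 z0 x0 : C).
Hypothesis g00 : g0 != 0.

Lemma three_W_differentiable v : differentiable (fun v => three_W v * g0 ^+ 2) v.
Proof. by rewrite /three_W; differentiate. Qed.

Lemma three_abM_differentiable v : 0 < complex.Re (three_W v * g0 ^+ 2) ->
  [/\ differentiable (three_g g0) v, differentiable (three_a g0) v,
      differentiable (three_b g0) v & differentiable (three_M g0) v].
Proof.
move=> hW; have dg : differentiable (fun c => three_g g0 c) v.
  by rewrite /three_g /three_W; differentiate; exact: hW.
have da : differentiable (fun c => three_a g0 c) v by rewrite /three_a; differentiate.
have db : differentiable (fun c => three_b g0 c) v by rewrite /three_b; differentiate.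
have dM : differentiable (fun c => three_M g0 c) v by rewrite /three_M; differentiate.
exact: And4 dg da db dM.
Qed.

Lemma three_F_differentiable v : 0 < complex.Re (three_W v * g0 ^+ 2) ->
  three_a g0 v + three_b g0 v != 0 ->
  differentiable (fun v => three_F g0 v * cexp (- z0)) v.
Proof.
move=> /three_abM_differentiable[dg da db dM] ab0; rewrite /three_F.
by differentiate; exact: ab0.
Qed.

Lemma three_ab_neq0 v : 0 < complex.Re (three_F g0 v * cexp (- z0)) ->
  three_a g0 v + three_b g0 v != 0.
Proof.
move=> /Re_neq0; apply: contraNneq; rewrite /three_F => ->.
by rewrite invr0 !mulr0 mul0r.
Qed.

Lemma three_M_neq0 v : 0 < complex.Re (three_F g0 v * cexp (- z0)) ->
  three_M g0 v != 0.
Proof.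
move=> /Re_neq0; apply: contraNneq; rewrite /three_F => ->.
by rewrite mulr0 mul0r mulr0 mul0r.
Qed.

Lemma three_X_differentiable v : 0 < complex.Re (three_W v * g0 ^+ 2) ->
  0 < complex.Re (three_F g0 v * cexp (- z0)) ->
  differentiable (three_z g0 z0) v /\
  differentiable (fun v => three_X g0 z0 v * cexp (- x0)) v.
Proof.
move=> hW hF; have [dg da db dM] := three_abM_differentiable hW.
have dF := three_F_differentiable hW (three_ab_neq0 hF).
have dz : differentiable (fun c => three_z g0 z0 c) v.
  rewrite /three_z; apply: difD; first exact: dif_cst.
  exact: dif_clog hF dF.
have dX : differentiable (fun c => three_X g0 z0 c * cexp (- x0)) v.
  by rewrite /three_X; differentiate.
exact: conj dz dX.
Qed.

Lemma three_inv_differentiable v : 0 < complex.Re (three_W v * g0 ^+ 2) ->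
  0 < complex.Re (three_F g0 v * cexp (- z0)) ->
  0 < complex.Re (three_X g0 z0 v * cexp (- x0)) ->
  differentiable (three_inv g0 z0 x0) v.
Proof.
move=> hW hF hX; have [dg da db dM] := three_abM_differentiable hW.
have [ab0 M0] := (three_ab_neq0 hF, three_M_neq0 hF).
have [dz dX] := three_X_differentiable hW hF.
have dF : differentiable (fun c => three_F g0 c) v.
  by rewrite /three_F; differentiate; exact: ab0.
have dx : differentiable (fun c => three_x g0 z0 x0 c) v.
  rewrite /three_x; apply: difD; first exact: dif_cst.
  exact: dif_clog hX dX.
have dy : differentiable (fun c => three_y g0 c) v.
  by rewrite /three_y; differentiate; exact: M0.
have y0 : three_y g0 v != 0.
  by rewrite /three_y mulf_neq0 ?mulf_neq0 ?invr_neq0 ?pnatr_eq0.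
have dI : differentiable (fun c => three_inv g0 z0 x0 c) v.
  by rewrite /three_inv; differentiate; first [exact: y0|exact: M0].
exact: dI.
Qed.
End differentiability.

Lemma chart_three_local : local_coordinates [set u | y u != 0] (chart_three s).
Proof.
move=> u0 /= y0; pose g0 := y u0 * E u0 ^+ 2; pose z0 := u0 0 2.
pose x0 := 3 / 2 * j * u0 0 0; pose v0 := chart_three s u0.
have [p0 Re1] := (Im0_strip R, Re1_gt0 R).
have g00 : g0 != 0 by rewrite mulf_neq0 ?expf_neq0 ?cexp_neq0.
have r1 : g0 * (y u0 * E u0 ^+ 2)^-1 = 1 by rewrite mulfV.
have gE : three_g g0 v0 = g0.
  by apply: three_g_chart => //; rewrite -/g0 mulfV// clog1 mulr0.
have W1 : three_W v0 * g0 ^+ 2 = 1.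
  by rewrite three_W_chart// -/g0 exprVn mulVf ?expf_neq0.
have F1 : three_F g0 v0 * cexp (- z0) = 1.
  by rewrite three_F_chart// -cexpD subrr cexp0.
have X1 : three_X g0 z0 v0 * cexp (- x0) = 1.
  have zE : three_z g0 z0 v0 = z0 by rewrite /three_z F1 clog1 addr0.
  rewrite /three_X zE three_M_chart// cexpN cexpN /x0 -/(E u0).
  by field; rewrite ?cexp_neq0.
have NW : \forall v \near v0, 0 < complex.Re (three_W v * g0 ^+ 2).
  exact: near_right (differentiable_continuous (@three_W_differentiable g0 v0)) W1.
have NF : \forall v \near v0, 0 < complex.Re (three_F g0 v * cexp (- z0)).
  have dF : differentiable (fun v => three_F g0 v * cexp (- z0)) v0.
    apply: three_F_differentiable; rewrite ?W1//.
    by apply: (@three_ab_neq0 _ z0); rewrite F1.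
  exact: near_right (differentiable_continuous dF) F1.
have NX : \forall v \near v0, 0 < complex.Re (three_X g0 z0 v * cexp (- x0)).
  have [] := @three_X_differentiable g0 z0 x0 v0; rewrite ?W1 ?F1// => _ dX.
  exact: near_right (differentiable_continuous dX) X1.
have oD : open [set u : C5 | y u != 0].
  rewrite openE => u /= yu; rewrite /interior.
  have : \forall v \near u, 0 < complex.Re (y (v : C5) * (y u)^-1).
    apply: near_right; last by rewrite mulfV.
    by apply: differentiable_continuous; differentiate.
  by apply: filterS => v /Re_neq0; apply: contraNneq => ->; rewrite mul0r.
have Ny : \forall u \near u0, y (u : C5) != 0.
  by rewrite openE in oD; exact: oD.
have NI : \forall v \near v0, [/\ 0 < complex.Re (three_W v * g0 ^+ 2),
    0 < complex.Re (three_F g0 v * cexp (- z0)) &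
    0 < complex.Re (three_X g0 z0 v * cexp (- x0))].
  by apply: filterS3 NW NF NX.
apply: (@biholomorphic_germ _ _ (three_inv g0 z0 x0) u0 v0 _ _ _ _ _ _ oD) => //.
- apply: filterS Ny => u yu; rewrite chart_threeE.
  by differentiate; exact: yu.
- by apply: filterS NI => v [? ? ?]; exact: three_inv_differentiable.
- have Nr : \forall u \near u0, 0 < complex.Re (g0 * (y (u : C5) * E u ^+ 2)^-1).
    apply: near_right; last exact: r1.
    by apply: differentiable_continuous; differentiate; exact: g00.
  have Nl : \forall u \near u0, - (pi / 2) <
      complex.Im (2 * clog (g0 * (y (u : C5) * E u ^+ 2)^-1)) < pi / 2.
    apply: near_strip; last by rewrite r1 clog1 mulr0.
    apply: differentiable_continuous; differentiate; last exact: g00.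
    by rewrite r1.
  have Nz : \forall u \near u0, - (pi / 2) < complex.Im ((u : C5) 0 2 - z0) < pi / 2.
    apply: near_strip; last by rewrite subrr.
    by apply: differentiable_continuous; differentiate.
  have Nx : \forall u \near u0, - (pi / 2) <
      complex.Im (3 / 2 * j * (u : C5) 0 0 - x0) < pi / 2.
    apply: near_strip; last by rewrite subrr.
    by apply: differentiable_continuous; differentiate.
  apply: filterS3 Ny (filterI Nr Nl) (filterI Nz Nx) => u yu [ru lu] [zu xu].
  by apply: three_invK => //; exact: three_g_chart.
- by apply: filterS NI => v [? ? ?]; exact: chart_three_inv.
Qed.
End three_inverse.

(** * Moving a point off y = 0 *)

Section symmetry.
Variable R : realType.
Local Notation C := (CC R).
Local Notation C5 := 'rV[C]_5.

Local Notation h b u := (1 + b * (u 0 3 * cexp (- u 0 2))).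
(** sigma_1, sigma_2, sigma_3 are combinations of the entries of the form M^-1 dM, for
    M the matrix with rows (E y, E) and ((1 + y p) / E, p / E); [shear] is the left
    translation that adds b times the second row to the first. *)
Definition shear (b : C) (u : C5) : C5 :=
  vec5 (u 0 0) (u 0 1 + b * (cexp (- u 0 2) * (h b u)^-1))
    (u 0 2 + 2 * clog (h b u)) (u 0 3 * h b u) (u 0 4).

Lemma shear_h b (u : C5) : 0 < complex.Re (h b u) -> h (- b) (shear b u) = (h b u)^-1.
Proof.
move=> hu; have h0 := Re_neq0 hu; rewrite !mxE /=.
have -> : cexp (- (u 0 2 + 2 * clog (h b u))) = cexp (- u 0 2) * (h b u)^-1 ^+ 2.
  by rewrite opprD cexpD (cexpN (2 * _)) mulr_natl -cexpX clogK// exprVn.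
by field.
Qed.

Lemma shearK b (u : C5) : 0 < complex.Re (h b u) -> shear (- b) (shear b u) = u.
Proof.
move=> hu; have h0 := Re_neq0 hu.
apply: vec5_eq; rewrite ?shear_h// ?clogV// !mxE /= ?addr0//.
- have -> : cexp (- (u 0 2 + 2 * clog (h b u))) = cexp (- u 0 2) * (h b u)^-1 ^+ 2.
    by rewrite opprD cexpD (cexpN (2 * _)) mulr_natl -cexpX clogK// exprVn.
  by field.
- by ring.
- by field.
Qed.

Lemma shear_differentiable b (u : C5) : 0 < complex.Re (h b u) ->
  differentiable (shear b) u.
Proof.
move=> hu; have ds : differentiable (fun u => shear b u) u.
  by rewrite /shear; differentiate; first [exact: hu|exact: Re_neq0 hu].
exact: ds.
Qed.

Lemma shear_pull b alpha (u : C5) : 0 < complex.Re (h b u) ->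
  forall i, pullbacks (shear b) (rolling alpha) i u = rolling alpha i u.
Proof.
move=> hu; have h0 := Re_neq0 hu; rewrite /pullbacks.
eassert (G : has_gradients (shear b) u _ _ _ _ _).
  by rewrite /shear; gradients; first [exact: hu|exact: Re_neq0 hu].
apply: forall_ord3; [pull G (rollingE alpha (shear b u)).1.1|
  pull G (rollingE alpha (shear b u)).1.2|
  pull G (rollingE alpha (shear b u)).2];
  rewrite !rollingE /shear !mxE /=; clear G; apply: cov5_eq; by field; rewrite ?h0.
Qed.

Lemma rolling_shear b alpha (u : C5) : 0 < complex.Re (h b u) ->
  locally_equivalent_at (rolling alpha) u (rolling alpha) (shear b u).
Proof.
move=> hu.
have near_h c (v : C5) : 0 < complex.Re (h c v) ->
    \forall w \near v, 0 < complex.Re (h c (w : C5)).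
  move=> hv; have h0 := Re_neq0 hv.
  have ch : {for v, continuous (fun w : C5 => complex.Re (h c w))}.
    apply: continuous_comp; last exact: Re_continuous.
    by apply: differentiable_continuous; differentiate.
  exact: (ch (fun t => 0 < t) (lt_nbhsr hv)).
have hv : 0 < complex.Re (h (- b) (shear b u)) by rewrite shear_h// ReV_gt0.
have Nu := near_h _ _ hu; have Nv := near_h _ _ hv.
have [U [V [UD Uu bi]]] : exists U V,
    [/\ U `<=` interior [set w : C5 | 0 < complex.Re (h b w)], U u &
        biholomorphic U V (shear b)].
  apply: (@biholomorphic_germ _ _ (shear (- b)) u (shear b u)
    _ _ _ _ _ _ (@open_interior _ _) Nu) => //.
  - by apply: filterS Nu => w; exact: shear_differentiable.
  - by apply: filterS Nv => w; exact: shear_differentiable.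
  - by apply: filterS Nu => w; exact: shearK.
  - by apply: filterS Nv => w hw; rewrite -{1}[b]opprK shearK.
exists U, V, (shear b); split=> //.
by apply: eq_span => w /UD/interior_subset hw i; rewrite shear_pull.
Qed.
End symmetry.

(** * Local equivalences *)

Section main.
Variable R : realType.
Local Notation C := (CC R).
Local Notation C5 := 'rV[C]_5.
Variable s : C.
Hypothesis s2 : s ^+ 2 = 1.

Lemma rolling_third_model u :
  locally_equivalent_at (rolling (s * ('i / 3))) u (@hilbert_cartan R) 0.
Proof.
apply: locally_equivalent_at_trans (Theta_model (chart_third s u)).
exact: locally_equivalent_at_chart (chart_third_local s2) (esym (chart_third_span s2)) _.
Qed.

Lemma rolling_three_model u :
  locally_equivalent_at (rolling (s * (3 * 'i))) u (@hilbert_cartan R) 0.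
Proof.
have ne0 (v : C5) : v 0 1 != 0 ->
    locally_equivalent_at (rolling (s * (3 * 'i))) v (@hilbert_cartan R) 0.
  move=> v0; apply: locally_equivalent_at_trans (Theta_model (chart_three s v)).
  exact: locally_equivalent_at_chart (chart_three_local s2) (esym (chart_three_span s2)) _.
have [y0|] := eqVneq (u 0 1) 0; last exact: ne0.
pose e := u 0 3 * cexp (- u 0 2).
(* A nonzero b with 1 + b e in the right half plane: then y moves to a nonzero
   value, b exp (- z) / (1 + b e). *)
have [b [b0 hb]] : exists b : C, b != 0 /\ 0 < complex.Re (1 + b * e).
  have [->|e0] := eqVneq e 0.
    by exists 1; rewrite oner_neq0 mulr0 addr0 Re1_gt0.
  exists e^-1; rewrite invr_neq0// mulVf//; split=> //.
  by apply: addr_gt0; exact: Re1_gt0.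
apply: locally_equivalent_at_trans (rolling_shear _ hb) (ne0 _ _).
rewrite !mxE /= y0 add0r !mulf_neq0 ?cexp_neq0// invr_neq0//.
exact: Re_neq0 hb.
Qed.
End main.

Unset Implicit Arguments.

Theorem mainTheorem4 (R : realType) :
  [/\ forall s : CC R, s = 1 \/ s = -1 ->
        local_coordinates setT (chart_third s) /\
        form_span setT (pullbacks (chart_third s) (@Theta R)) =
        form_span setT (rolling (s * ('i / 3))),
      forall s : CC R, s = 1 \/ s = -1 ->
        let D := [set u : 'rV[CC R]_5 | u 0 1 != 0] in
        local_coordinates D (chart_three s) /\
        form_span D (pullbacks (chart_three s) (@Theta R)) =
        form_span D (rolling (s * (3 * 'i))) &
      forall alpha : CC R,
        alpha \in [:: 'i / 3; - ('i / 3); 3 * 'i; - (3 * 'i)] ->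
        locally_equivalent (rolling alpha) (@flat_cartan R) /\
        locally_equivalent (rolling alpha) (@hilbert_cartan R)].
Proof.
have sq (s : CC R) : s = 1 \/ s = -1 -> s ^+ 2 = 1.
  by case=> ->; rewrite ?sqrrN expr1n.
split=> [s /sq s2|s /sq s2 D|alpha alphaE].
- by split; [exact: chart_third_local|exact: chart_third_span].
- by split; [exact: chart_three_local|exact: chart_three_span].
have model u : locally_equivalent_at (rolling alpha) u (@hilbert_cartan R) 0.
  have [s1 sN1] : (1 : CC R) ^+ 2 = 1 /\ (-1 : CC R) ^+ 2 = 1 by rewrite sqrrN expr1n.
  move: alphaE; rewrite !inE => /or4P[] /eqP ->.
  - by have := rolling_third_model s1 u; rewrite mul1r.
  - by have := rolling_third_model sN1 u; rewrite mulN1r.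
  - by have := rolling_three_model s1 u; rewrite mul1r.
  - by have := rolling_three_model sN1 u; rewrite mulN1r.
split; first exact: locally_equivalent_model model (@flat_cartan_model R).
exact: locally_equivalent_model model (@hc_homogeneous R).
Qed.
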